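(* Let $M\subset\mathbb{R}^4$ be the corank $1$ surface at $p=0$ locally parametrised by $$f(x,y)=\left(x,\ xy+h(y),\ \sum_{i+j=2,3}b_{ij}x^iy^j,\ c_{20}x^2+\sum_{i+j=3}c_{ij}x^iy^j\right)+o(4),$$ with $b_{ij},c_{ij}\in\mathbb{R}$, $b_{02}c_{03}\neq0$ and $h$ of order at least $4$. Let $v=(0,0,0,v_4)\in\mathbb{S}^3$ with $v_4\neq0$, let $\Gamma_v$ be the hyperplane through $p$ orthogonal to $v$, and let $h_v(x,y)=\langle f(x,y),v\rangle$. Then $\Gamma_v$ contains both $E_p$ and $C_pM$, and the height function $h_v$ has a singularity of type $A_2$ at the origin, which is described by the contact of the zero fibre of the submersion $g_4=\pm W\pm X^2$ with the model surface $\mathtt{X}$, if and only if $\kappa_u(p)\neq0$.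
   Context: Coordinates in $\mathbb{R}^4$ are $(X,Y,Z,W)$; $o(4)$ is a remainder whose components have order at least $4$ in $(x,y)$. $\mathtt{X}$ is the surface parametrised by $(x,y)\mapsto(x,xy,y^2,y^3)$. The contact of the zero fibre of a submersion $g$ with $\mathtt{X}$ is given by the singularity type at the origin of the composition $g(x,xy,y^2,y^3)$. A function germ of two variables has a singularity of type $A_2$ if, up to smooth change of coordinates in the source and sign, it is $y^2+x^3$. $T_pM$ is the image of $df_0$ (the $X$-axis) and $N_pM$ its orthogonal complement. Let $II$ be the second fundamental form at $p$: the symmetric bilinear map on $\mathbb{R}^2$ given by the second derivatives $f_{xx},f_{xy},f_{yy}$ at $0$ projected orthogonally to $N_pM$. The curvature parabola is $\Delta_p=\{II(\mathbf u,\mathbf u):|df_0(\mathbf u)|=1\}\subset N_pM$; here it is a non-degenerate parabola. $\mathcal{A}ff_p$ is the smallest affine space containing $\Delta_p$, and $E_p$ is the vector plane parallel to $\mathcal{A}ff_p$ (here the $YZ$-plane). The umbilic curvature of $M$ at $p$ is $\kappa_u(p)=d(p,\mathcal{A}ff_p)$, the distance in $N_pM$ from $p$ (the origin of $N_pM$) to $\mathcal{A}ff_p$. $C_pM$ denotes the tangent cone of $M$ at $p$, taken in the paper to be the $XZ$-plane. *)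

(* Defs.v *)
From Stdlib Require Export Reals.
From Coquelicot Require Export Coquelicot.
Open Scope R_scope.

(** * Vectors of R^4, with coordinates (X, Y, Z, W) *)

Notation R4 := (R * R * R * R)%type.

Definition cX (w : R4) : R := fst (fst (fst w)).
Definition cY (w : R4) : R := snd (fst (fst w)).
Definition cZ (w : R4) : R := snd (fst w).
Definition cW (w : R4) : R := snd w.

Definition dot (u w : R4) : R :=
  cX u * cX w + cY u * cY w + cZ u * cZ w + cW u * cW w.
Definition norm4 (w : R4) : R := sqrt (dot w w).
Definition dist4 (u w : R4) : R := norm4 (minus u w).

Definition affine_subspace (A : R4 -> Prop) : Prop :=
  forall (a b : R4) (t : R), A a -> A b -> A (plus a (scal t (minus b a))).
Definition affine_hull (S : R4 -> Prop) (w : R4) : Prop :=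
  forall A : R4 -> Prop,
    affine_subspace A -> (forall s, S s -> A s) -> A w.
Definition affine_direction (A : R4 -> Prop) (w : R4) : Prop :=
  exists a b, A a /\ A b /\ w = minus a b.

(** * Smooth germs at the origin *)

Definition smooth1_germ (h : R -> R) : Prop :=
  locally 0 (fun y => forall n, ex_derive_n h n y).
Definition smooth_germ (g : R -> R -> R) : Prop :=
  locally_2d (fun x y => forall n, ex_diff_n g n x y) 0 0.

Definition order1_ge (k : nat) (h : R -> R) : Prop :=
  forall i, (i < k)%nat -> Derive_n h i 0 = 0.
Definition order_ge (k : nat) (g : R -> R -> R) : Prop :=
  forall i j, (i + j < k)%nat -> partial_derive i j g 0 0 = 0.

(* [(p1, p2)] is a local diffeomorphism of the plane at the origin, fixing it;
   [(q1, q2)] is its local inverse. *)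
Definition diffeo_germ (p1 p2 : R -> R -> R) : Prop :=
  smooth_germ p1 /\ smooth_germ p2 /\ p1 0 0 = 0 /\ p2 0 0 = 0 /\
  exists q1 q2 : R -> R -> R,
    smooth_germ q1 /\ smooth_germ q2 /\ q1 0 0 = 0 /\ q2 0 0 = 0 /\
    locally_2d (fun x y => q1 (p1 x y) (p2 x y) = x /\
                           q2 (p1 x y) (p2 x y) = y) 0 0 /\
    locally_2d (fun x y => p1 (q1 x y) (q2 x y) = x /\
                           p2 (q1 x y) (q2 x y) = y) 0 0.

Definition right_equiv (g k : R -> R -> R) : Prop :=
  exists p1 p2 : R -> R -> R,
    diffeo_germ p1 p2 /\
    locally_2d (fun x y => g (p1 x y) (p2 x y) = k x y) 0 0.

Definition is_sign (s : R) : Prop := s = 1 \/ s = -1.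

Definition singularity_A2 (g : R -> R -> R) : Prop :=
  exists s, is_sign s /\ right_equiv g (fun x y => s * (y ^ 2 + x ^ 3)).

(** * Second order geometry at the origin of a surface parametrised by [f] *)

Definition partial4 (i j : nat) (f : R -> R -> R4) : R4 :=
  (partial_derive i j (fun x y => cX (f x y)) 0 0,
   partial_derive i j (fun x y => cY (f x y)) 0 0,
   partial_derive i j (fun x y => cZ (f x y)) 0 0,
   partial_derive i j (fun x y => cW (f x y)) 0 0).

Definition df0 (f : R -> R -> R4) (u : R * R) : R4 :=
  plus (scal (fst u) (partial4 1 0 f)) (scal (snd u) (partial4 0 1 f)).

Definition tangent_space (f : R -> R -> R4) (w : R4) : Prop :=
  exists u, w = df0 f u.
Definition normal_space (f : R -> R -> R4) (w : R4) : Prop :=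
  forall t, tangent_space f t -> dot w t = 0.

Definition normal_projection (f : R -> R -> R4) (w n : R4) : Prop :=
  normal_space f n /\ tangent_space f (minus w n).

Definition d2f0 (f : R -> R -> R4) (u w : R * R) : R4 :=
  plus (plus (scal (fst u * fst w) (partial4 2 0 f))
             (scal (fst u * snd w + snd u * fst w) (partial4 1 1 f)))
       (scal (snd u * snd w) (partial4 0 2 f)).

(* [second_fundamental_form f u w n] reads [n = II(u, w)]. *)
Definition second_fundamental_form
    (f : R -> R -> R4) (u w : R * R) (n : R4) : Prop :=
  normal_projection f (d2f0 f u w) n.

Definition curvature_parabola (f : R -> R -> R4) (n : R4) : Prop :=
  exists u, norm4 (df0 f u) = 1 /\ second_fundamental_form f u u n.

Definition Aff_p (f : R -> R -> R4) : R4 -> Prop :=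
  affine_hull (curvature_parabola f).
Definition E_p (f : R -> R -> R4) : R4 -> Prop :=
  affine_direction (Aff_p f).

(* The infimum of the distances from [p = 0] to the points of [Aff_p f]. *)
Definition umbilic_curvature (f : R -> R -> R4) : R :=
  real (Glb_Rbar (fun d => exists w, Aff_p f w /\ d = dist4 zero w)).

(* The tangent cone is the whole XZ-plane, the zero set of the initial forms of
   the equations of the image, e.g. Y^2 = X^2 Z and W^2 = Z^3 for the model
   surface; limits of secants alone would only give one half of that plane. *)
Definition tangent_cone_XZ (w : R4) : Prop := cY w = 0 /\ cW w = 0.

Definition hyperplane_orth (v w : R4) : Prop := dot w v = 0.
Definition height (f : R -> R -> R4) (v : R4) (x y : R) : R := dot (f x y) v.

(** * Contact with the model surface *)

Definition model_surface (x y : R) : R4 := (x, x * y, y ^ 2, y ^ 3).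

Definition submersion_germ (g : R4 -> R) : Prop :=
  exists l : R4 -> R,
    filterdiff g (locally (zero : R4)) l /\ exists w, l w <> 0.

(* The contact of [g = 0] with the model surface is the singularity type of
   the composition of [g] with its parametrisation; it describes [k] when [k]
   has that singularity type. *)
Definition described_by_contact (k : R -> R -> R) (g : R4 -> R) : Prop :=
  submersion_germ g /\
  right_equiv k (fun x y => g (model_surface x y)).

Definition g4 (s1 s2 : R) (w : R4) : R := s1 * cW w + s2 * cX w ^ 2.

(** * The parametrisation *)

(* The homogeneous part of degree [k], the sum of [a i j * x^i * y^j] over
   [i + j = k]. *)
Definition homog (k : nat) (a : nat -> nat -> R) (x y : R) : R :=
  sum_f_R0 (fun i => a i (k - i)%nat * x ^ i * y ^ (k - i)) k.

(* Main.v *)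
From Stdlib Require Import Lra Lia ClassicalEpsilon.
Require Import Defs.

(** By Hadamard's lemma the height function is
    [y^3 N + x y^2 B + x^2 C] with [N], [B], [C] smooth, [N(0) = v4 c03] and
    [C(0) = v4 c20].  If [c20 <> 0], completing the square gives
    [C (x + y^2 B / (2 C))^2 + y^3 (N - y B^2 / (4 C))], so the square root of
    [|C|] and the cube root of the last factor provide coordinates in which it
    is [+- x^2 +- y^3]; this is both the A2 normal form and the composition of
    [+- W +- X^2] with the model surface.  If [c20 = 0], the 2-jet vanishes,
    which A2 excludes.  Finally the curvature parabola spans the plane
    [X = 0, W = 2 c20], whose distance to the origin is [2 |c20|]. *)

(** * Functions of class C^n on open sets of the plane *)

(** In the expansion of the remainder in powers of $x$, the coefficient of $x^2$ vanishes at the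
    origin because $r_{xx}(0)=0$, and the part free of $x$ is divisible by $y^4$; this is why $N(0)$
    and $C(0)$ depend on $c_{03}$ and $c_{20}$ alone.

    The main obstacle is regularity: the Hadamard quotients, the roots and the inverse coordinate
    change must all be smooth in the sense of [ex_diff_n], a recursion on partial derivatives at one
    point, which does not compose well. Imposed on a whole open set, it makes the partials
    continuous there and yields a total differential, so that the chain rule supports inductions on
    the order.

    The coordinate change has the form $(u, yM)$ and is inverted one variable at a time; this
    reduces the inverse function theorem in the plane to a scalar implicit function, obtained from
    monotonicity. In the degenerate case no Hessian is transported: the $A_2$ form is refuted by its
    values on a single curve. *)

Definition open2 (U : R -> R -> Prop) : Prop :=
  forall x y, U x y -> locally_2d U x y.

Definition Cn (U : R -> R -> Prop) (n : nat) (F : R -> R -> R) : Prop :=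
  forall x y, U x y -> ex_diff_n F n x y.

Definition smooth_on (U : R -> R -> Prop) (F : R -> R -> R) : Prop :=
  forall n, Cn U n F.

Definition dx (F : R -> R -> R) (x y : R) : R := Derive (fun z => F z y) x.
Definition dy (F : R -> R -> R) (x y : R) : R := Derive (fun z => F x z) y.

Lemma Cn_ext U n F G :
  open2 U -> (forall x y, U x y -> F x y = G x y) -> Cn U n F -> Cn U n G.
Proof.
  intros oU e HF x y Uxy. apply ex_diff_n_ext_loc with F; [|now apply HF].
  apply locally_2d_impl with U; [apply locally_2d_forall; exact e|now apply oU].
Qed.

Lemma Cn_le U n m F : (m <= n)%nat -> Cn U n F -> Cn U m F.
Proof. intros le HF x y Uxy. now apply ex_diff_n_m with n; [|apply HF]. Qed.

Lemma Cn_sub U V n F : (forall x y, V x y -> U x y) -> Cn U n F -> Cn V n F.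
Proof. intros s HF x y Vxy. now apply HF, s. Qed.

Lemma Cn_continuity U n F x y : Cn U n F -> U x y -> continuity_2d_pt F x y.
Proof. intros HF Uxy. specialize (HF x y Uxy). destruct n; apply HF. Qed.

(** The recursion of [ex_diff_n] speaks of [Derive]; [Cn_ext] lets the explicit partials [G1] and
    [G2] stand in for it. The hypothesis is a total differential because that is what the chain rule
    delivers, and the closure properties below are inductions on [n] through this lemma. *)
Lemma Cn_intro U n F G1 G2 :
  open2 U ->
  (forall x y, U x y -> differentiable_pt_lim F x y (G1 x y) (G2 x y)) ->
  Cn U n G1 -> Cn U n G2 -> Cn U (S n) F.
Proof.
  intros oU HF C1 C2 x y Uxy.
  assert (d1 : forall x y, U x y -> is_derive (fun z => F z y) x (G1 x y)).
  { intros a b Uab. apply is_derive_Reals.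
    replace (G1 a b) with (G1 a b * 1 + G2 a b * 0) by ring.
    apply (derivable_pt_lim_comp_2d F (fun z => z) (fun _ => b)).
    - now apply HF.
    - apply derivable_pt_lim_id.
    - apply derivable_pt_lim_const. }
  assert (d2 : forall x y, U x y -> is_derive (fun z => F x z) y (G2 x y)).
  { intros a b Uab. apply is_derive_Reals.
    replace (G2 a b) with (G1 a b * 0 + G2 a b * 1) by ring.
    apply (derivable_pt_lim_comp_2d F (fun _ => a) (fun z => z)).
    - now apply HF.
    - apply derivable_pt_lim_const.
    - apply derivable_pt_lim_id. }
  simpl. repeat split.
  - apply differentiable_continuity_pt. exists (G1 x y), (G2 x y). now apply HF.
  - exists (G1 x y). now apply d1.
  - exists (G2 x y). now apply d2.
  - apply (Cn_ext U n G1); auto. intros a b Uab. symmetry.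
    now apply is_derive_unique, d1.
  - apply (Cn_ext U n G2); auto. intros a b Uab. symmetry.
    now apply is_derive_unique, d2.
Qed.

Lemma Cn_dx U n F : Cn U (S n) F -> Cn U n (dx F).
Proof. intros HF x y Uxy. apply (HF x y Uxy). Qed.

Lemma Cn_dy U n F : Cn U (S n) F -> Cn U n (dy F).
Proof. intros HF x y Uxy. apply (HF x y Uxy). Qed.

(** Partials that exist on an open set, the one in [x] being continuous, give a total differential.
    This provides the input of the chain rule, whose output goes to [Cn_intro]. *)
Lemma Cn_differentiable U n F x y :
  open2 U -> Cn U (S n) F -> U x y ->
  differentiable_pt_lim F x y (dx F x y) (dy F x y).
Proof.
  intros oU HF Uxy. apply filterdiff_differentiable_pt_lim.
  apply (is_derive_filterdiff F x y (dx F) (dy F x y)).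
  - apply (proj1 (locally_2d_locally (fun a b => is_derive (fun z => F z b) a (dx F a b)) x y)).
    apply locally_2d_impl with U; [|now apply oU].
    apply locally_2d_forall. intros a b Uab. apply Derive_correct, (HF a b Uab).
  - apply Derive_correct, (HF x y Uxy).
  - apply (proj1 (continuity_2d_pt_filterlim (dx F) x y)).
    now apply Cn_continuity with U n; [apply Cn_dx|].
Qed.

Lemma differentiable_pt_lim_const k x y :
  differentiable_pt_lim (fun _ _ => k) x y 0 0.
Proof.
  intros eps. apply locally_2d_forall. intros u v.
  replace (k - k - (0 * (u - x) + 0 * (v - y))) with 0 by ring.
  rewrite Rabs_R0. apply Rmult_le_pos; [left; apply cond_pos|].
  eapply Rle_trans; [apply Rabs_pos|apply Rmax_l].
Qed.

Lemma differentiable_pt_lim_fst x y :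
  differentiable_pt_lim (fun u _ => u) x y 1 0.
Proof. apply differentiable_pt_lim_proj1_0, derivable_pt_lim_id. Qed.

Lemma differentiable_pt_lim_snd x y :
  differentiable_pt_lim (fun _ v => v) x y 0 1.
Proof.
  intros eps. apply locally_2d_forall. intros u v.
  replace (v - y - (0 * (u - x) + 1 * (v - y))) with 0 by ring.
  rewrite Rabs_R0. apply Rmult_le_pos; [left; apply cond_pos|].
  eapply Rle_trans; [apply Rabs_pos|apply Rmax_l].
Qed.

(** Sums and products are treated as compositions with [u + v] and [u * v], so that the two-variable
    chain rule differentiates both. *)
Lemma differentiable_pt_lim_add x y :
  differentiable_pt_lim (fun u v => u + v) x y 1 1.
Proof.
  intros eps. apply locally_2d_forall. intros u v.
  replace (u + v - (x + y) - (1 * (u - x) + 1 * (v - y))) with 0 by ring.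
  rewrite Rabs_R0. apply Rmult_le_pos; [left; apply cond_pos|].
  eapply Rle_trans; [apply Rabs_pos|apply Rmax_l].
Qed.

Lemma differentiable_pt_lim_mul x y :
  differentiable_pt_lim (fun u v => u * v) x y y x.
Proof.
  intros eps. exists eps. intros u v Hu Hv.
  replace (u * v - x * y - (y * (u - x) + x * (v - y)))
    with ((u - x) * (v - y)) by ring.
  rewrite Rabs_mult. apply Rmult_le_compat; try apply Rabs_pos.
  - now left.
  - apply Rmax_r.
Qed.

Lemma Cn_const U n k : open2 U -> Cn U n (fun _ _ => k).
Proof.
  intros oU. revert k. induction n as [|n IH]; intros k.
  - intros x y _. split; [apply continuity_2d_pt_const|exact I].
  - apply Cn_intro with (fun _ _ => 0) (fun _ _ => 0); auto.
    intros x y _. apply differentiable_pt_lim_const.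
Qed.

Lemma Cn_fst U n : open2 U -> Cn U n (fun x _ => x).
Proof.
  intros oU. destruct n as [|n].
  - intros x y _. split; [apply continuity_2d_pt_id1|exact I].
  - apply Cn_intro with (fun _ _ => 1) (fun _ _ => 0); auto using Cn_const.
    intros x y _. apply differentiable_pt_lim_fst.
Qed.

Lemma Cn_snd U n : open2 U -> Cn U n (fun _ y => y).
Proof.
  intros oU. destruct n as [|n].
  - intros x y _. split; [apply continuity_2d_pt_id2|exact I].
  - apply Cn_intro with (fun _ _ => 0) (fun _ _ => 1); auto using Cn_const.
    intros x y _. apply differentiable_pt_lim_snd.
Qed.

Lemma Cn_plus U n F G :
  open2 U -> Cn U n F -> Cn U n G -> Cn U n (fun x y => F x y + G x y).
Proof.
  intros oU. revert F G. induction n as [|n IH]; intros F G HF HG.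
  - intros x y Uxy. split; [|exact I].
    apply continuity_2d_pt_plus; now apply Cn_continuity with U 0%nat.
  - apply Cn_intro with (fun x y => dx F x y + dx G x y)
      (fun x y => dy F x y + dy G x y); auto using Cn_dx, Cn_dy.
    intros x y Uxy.
    replace (dx F x y + dx G x y) with (1 * dx F x y + 1 * dx G x y) by ring.
    replace (dy F x y + dy G x y) with (1 * dy F x y + 1 * dy G x y) by ring.
    apply (differentiable_pt_lim_comp (fun u v => u + v));
      eauto using differentiable_pt_lim_add, Cn_differentiable.
Qed.

Lemma Cn_mult U n F G :
  open2 U -> Cn U n F -> Cn U n G -> Cn U n (fun x y => F x y * G x y).
Proof.
  intros oU. revert F G. induction n as [|n IH]; intros F G HF HG.
  - intros x y Uxy. split; [|exact I].
    apply continuity_2d_pt_mult; now apply Cn_continuity with U 0%nat.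
  - assert (HF' : Cn U n F) by (apply Cn_le with (S n); auto).
    assert (HG' : Cn U n G) by (apply Cn_le with (S n); auto).
    apply Cn_intro with (fun x y => G x y * dx F x y + F x y * dx G x y)
      (fun x y => G x y * dy F x y + F x y * dy G x y);
      auto using Cn_dx, Cn_dy, Cn_plus.
    intros x y Uxy.
    apply (differentiable_pt_lim_comp (fun u v => u * v));
      eauto using differentiable_pt_lim_mul, Cn_differentiable.
Qed.

Lemma continuity_2d_pt_comp (F P Q : R -> R -> R) x y :
  continuity_2d_pt F (P x y) (Q x y) ->
  continuity_2d_pt P x y -> continuity_2d_pt Q x y ->
  continuity_2d_pt (fun u v => F (P u v) (Q u v)) x y.
Proof.
  intros HF HP HQ eps. destruct (HF eps) as [d Hd].
  apply locally_2d_impl with (2 := locally_2d_and _ _ _ _ (HP d) (HQ d)).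
  apply locally_2d_forall. intros u v [H1 H2]. now apply Hd.
Qed.

Lemma locally_2d_comp (W : R -> R -> Prop) (P Q : R -> R -> R) x y :
  locally_2d W (P x y) (Q x y) ->
  continuity_2d_pt P x y -> continuity_2d_pt Q x y ->
  locally_2d (fun u v => W (P u v) (Q u v)) x y.
Proof.
  intros [d Hd] HP HQ.
  apply locally_2d_impl with (2 := locally_2d_and _ _ _ _ (HP d) (HQ d)).
  apply locally_2d_forall. intros u v [H1 H2]. now apply Hd.
Qed.

Lemma Cn_comp U V n F P Q :
  open2 U -> open2 V -> (forall x y, U x y -> V (P x y) (Q x y)) ->
  Cn V n F -> Cn U n P -> Cn U n Q -> Cn U n (fun x y => F (P x y) (Q x y)).
Proof.
  intros oU oV UV. revert F. induction n as [|n IH]; intros F HF HP HQ.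
  - intros x y Uxy. split; [|exact I].
    apply continuity_2d_pt_comp;
      [apply Cn_continuity with V 0%nat|apply Cn_continuity with U 0%nat
      |apply Cn_continuity with U 0%nat]; auto.
  - assert (HP' : Cn U n P) by (apply Cn_le with (S n); auto).
    assert (HQ' : Cn U n Q) by (apply Cn_le with (S n); auto).
    apply Cn_intro with
      (fun x y => dx F (P x y) (Q x y) * dx P x y + dy F (P x y) (Q x y) * dx Q x y)
      (fun x y => dx F (P x y) (Q x y) * dy P x y + dy F (P x y) (Q x y) * dy Q x y);
      auto using Cn_dx, Cn_dy, Cn_plus, Cn_mult.
    intros x y Uxy.
    apply (differentiable_pt_lim_comp F); eauto using Cn_differentiable.
Qed.

Definition right_half (x y : R) : Prop := 0 < x.

Lemma open2_right_half : open2 right_half.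
Proof.
  intros x y Hx. exists (mkposreal x Hx). intros u v Hu _. simpl in Hu.
  apply Rabs_lt_between in Hu. unfold right_half in *. lra.
Qed.

(** Reciprocals, square roots and cube roots are all real powers, and the derivative of a power is a
    multiple of another power; hence the induction quantifies over the exponent. *)
Lemma Cn_Rpower n a : Cn right_half n (fun x _ => Rpower x a).
Proof.
  assert (D : forall a x y, right_half x y ->
    differentiable_pt_lim (fun x _ => Rpower x a) x y (a * Rpower x (a - 1)) 0).
  { intros b x y Hx. apply (differentiable_pt_lim_proj1_0 (fun x => Rpower x b)).
    now apply derivable_pt_lim_power. }
  pose proof open2_right_half as oH. revert a.
  induction n as [|n IH]; intros a.
  - intros x y Hx. split; [|exact I]. apply differentiable_continuity_pt.
    exists (a * Rpower x (a - 1)), 0. now apply D.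
  - apply Cn_intro with (fun x _ => a * Rpower x (a - 1)) (fun _ _ => 0);
      auto using Cn_const, Cn_mult.
Qed.

Lemma Cn_Rpower_comp U n a F :
  open2 U -> (forall x y, U x y -> 0 < F x y) -> Cn U n F ->
  Cn U n (fun x y => Rpower (F x y) a).
Proof.
  intros oU pF HF.
  apply (Cn_comp U right_half n (fun x _ => Rpower x a) F (fun _ _ => 0));
    auto using open2_right_half, Cn_Rpower, Cn_const.
Qed.

(** * Integrals along horizontal rays *)

(** Differentiation under the integral sign yields partial derivatives only; the continuity of [G1]
    upgrades them to a total differential. *)
Lemma Cn_intro_partial U n F G1 G2 :
  open2 U ->
  (forall x y, U x y -> is_derive (fun z => F z y) x (G1 x y)) ->
  (forall x y, U x y -> is_derive (fun z => F x z) y (G2 x y)) ->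
  Cn U n G1 -> Cn U n G2 -> Cn U (S n) F.
Proof.
  intros oU D1 D2 C1 C2. apply Cn_intro with G1 G2; auto.
  intros x y Uxy. apply filterdiff_differentiable_pt_lim.
  apply (is_derive_filterdiff F x y G1 (G2 x y)); auto.
  - apply (proj1 (locally_2d_locally (fun a b => is_derive (fun z => F z b) a (G1 a b)) x y)).
    apply locally_2d_impl with U; [|now apply oU].
    apply locally_2d_forall. exact D1.
  - apply (proj1 (continuity_2d_pt_filterlim G1 x y)).
    now apply Cn_continuity with U n.
Qed.

Definition box (d x y : R) : Prop := Rabs x < d /\ Rabs y < d.

Lemma open2_box d : open2 (box d).
Proof.
  intros x y [Hx Hy].
  assert (p : 0 < Rmin (d - Rabs x) (d - Rabs y)) by (apply Rmin_pos; lra).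
  exists (mkposreal _ p). simpl. intros u v Hu Hv.
  pose proof (Rmin_l (d - Rabs x) (d - Rabs y)).
  pose proof (Rmin_r (d - Rabs x) (d - Rabs y)).
  pose proof (Rabs_triang (u - x) x). pose proof (Rabs_triang (v - y) y).
  replace (u - x + x) with u in * by ring. replace (v - y + y) with v in * by ring.
  split; lra.
Qed.

Lemma box_scale d t x y : 0 <= t <= 1 -> box d x y -> box d (t * x) y.
Proof.
  intros Ht [Hx Hy]. split; [|exact Hy]. rewrite Rabs_mult, (Rabs_pos_eq t) by lra.
  pose proof (Rabs_pos x). nra.
Qed.

(** Differentiating in [x] brings out a factor [t]; the weight [t ^ m] makes the family stable under
    both partial derivatives. Applied to [dx H], the case [m = 0] is the Hadamard quotient. *)
Definition ray_integral (m : nat) (H : R -> R -> R) (x y : R) : R :=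
  RInt (fun t => t ^ m * H (t * x) y) 0 1.

Lemma continuity_2d_pt_pow2 m x t : continuity_2d_pt (fun _ v => v ^ m) x t.
Proof.
  induction m as [|m IH]; simpl; [apply continuity_2d_pt_const|].
  apply continuity_2d_pt_mult; [apply continuity_2d_pt_id2|exact IH].
Qed.

Lemma ray_integrand_continuity_x m H t x y :
  continuity_2d_pt H (t * x) y ->
  continuity_2d_pt (fun u v => v ^ m * H (v * u) y) x t.
Proof.
  intros cH. apply continuity_2d_pt_mult; [apply continuity_2d_pt_pow2|].
  apply (continuity_2d_pt_comp H (fun u v => v * u) (fun _ _ => y)); auto.
  - apply continuity_2d_pt_mult; [apply continuity_2d_pt_id2|apply continuity_2d_pt_id1].
  - apply continuity_2d_pt_const.
Qed.

Lemma ray_integrand_continuity_y m H t x y :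
  continuity_2d_pt H (t * x) y ->
  continuity_2d_pt (fun u v => v ^ m * H (v * x) u) y t.
Proof.
  intros cH. apply continuity_2d_pt_mult; [apply continuity_2d_pt_pow2|].
  apply (continuity_2d_pt_comp H (fun _ v => v * x) (fun u _ => u)); auto.
  - apply continuity_2d_pt_mult; [apply continuity_2d_pt_id2|apply continuity_2d_pt_const].
  - apply continuity_2d_pt_id1.
Qed.

Lemma continuity_2d_pt_snd_slice F x y :
  continuity_2d_pt F x y -> continuous (fun v => F x v) y.
Proof.
  intros cF. apply continuity_pt_filterlim. intros eps Heps.
  destruct (cF (mkposreal eps Heps)) as [d Hd]. exists d. split; [apply cond_pos|].
  intros v [_ Hv]. apply Hd; [|exact Hv].
  unfold Rminus. rewrite Rplus_opp_r, Rabs_R0. apply cond_pos.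
Qed.

Lemma ray_integrable d m H x y :
  Cn (box d) 0 H -> box d x y -> ex_RInt (fun t => t ^ m * H (t * x) y) 0 1.
Proof.
  intros cH Bxy. apply (ex_RInt_continuous (V := R_CompleteNormedModule)).
  intros t Ht. rewrite Rmin_left, Rmax_right in Ht by lra.
  apply (continuity_2d_pt_snd_slice (fun u v => v ^ m * H (v * u) y)).
  apply ray_integrand_continuity_x, Cn_continuity with (box d) 0%nat; auto.
  now apply box_scale.
Qed.

Lemma locally_box_x d x y : box d x y -> locally x (fun u => box d u y).
Proof. intros B. apply (locally_2d_1d_const_y (box d)), open2_box, B. Qed.

Lemma locally_box_y d x y : box d x y -> locally y (fun v => box d x v).
Proof. intros B. apply (locally_2d_1d_const_x (box d)), open2_box, B. Qed.

Lemma ray_integrand_derive_x U m H t x y :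
  Cn U 1 H -> U (t * x) y ->
  is_derive (fun u => t ^ m * H (t * u) y) x (t ^ S m * dx H (t * x) y).
Proof.
  intros cH B.
  replace (t ^ S m * dx H (t * x) y) with (t ^ m * (t * dx H (t * x) y)) by (simpl; ring).
  apply is_derive_scal.
  apply (is_derive_comp (fun z => H z y) (fun u => t * u)).
  - apply Derive_correct, (cH (t * x) y B).
  - auto_derive; [exact I|ring].
Qed.

Lemma ray_integrand_derive_y U m H t x y :
  Cn U 1 H -> U (t * x) y ->
  is_derive (fun u => t ^ m * H (t * x) u) y (t ^ m * dy H (t * x) y).
Proof. intros cH B. apply is_derive_scal, Derive_correct, (cH (t * x) y B). Qed.

Lemma ray_integral_derive_x d m H x y :
  Cn (box d) 1 H -> box d x y ->
  is_derive (fun z => ray_integral m H z y) x (ray_integral (S m) (dx H) x y).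
Proof.
  intros cH B.
  assert (e : forall t, 0 <= t <= 1 ->
    Derive (fun u => t ^ m * H (t * u) y) x = t ^ S m * dx H (t * x) y).
  { intros t Ht. apply is_derive_unique, ray_integrand_derive_x with (box d); auto.
    now apply box_scale. }
  unfold ray_integral at 2.
  rewrite <- (RInt_ext (fun t => Derive (fun u => t ^ m * H (t * u) y) x)).
  2:{ intros t Ht. rewrite Rmin_left, Rmax_right in Ht by lra. apply e; lra. }
  apply (is_derive_RInt_param (fun x t => t ^ m * H (t * x) y)).
  - apply filter_imp with (2 := locally_box_x d x y B). intros u Bu t Ht.
    rewrite Rmin_left, Rmax_right in Ht by lra.
    exists (t ^ S m * dx H (t * u) y). apply ray_integrand_derive_x with (box d); auto.
    now apply box_scale.
  - intros t Ht. rewrite Rmin_left, Rmax_right in Ht by lra.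
    assert (Bt : box d (t * x) y) by now apply box_scale.
    apply continuity_2d_pt_ext_loc with (fun u v => v ^ S m * dx H (v * u) y).
    + apply locally_2d_impl with (fun u v => box d (v * u) y).
      * apply locally_2d_forall. intros u v Buv. symmetry.
        apply is_derive_unique, ray_integrand_derive_x with (box d); auto.
      * apply (locally_2d_comp (box d) (fun u v => v * u) (fun _ _ => y)).
        -- now apply open2_box.
        -- apply continuity_2d_pt_mult;
             [apply continuity_2d_pt_id2|apply continuity_2d_pt_id1].
        -- apply continuity_2d_pt_const.
    + apply ray_integrand_continuity_x, Cn_continuity with (box d) 0%nat; auto.
      now apply Cn_dx.
  - apply filter_imp with (2 := locally_box_x d x y B). intros u Bu.
    apply ray_integrable with d; auto. apply Cn_le with 1%nat; auto.
Qed.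

Lemma ray_integral_derive_y d m H x y :
  Cn (box d) 1 H -> box d x y ->
  is_derive (fun z => ray_integral m H x z) y (ray_integral m (dy H) x y).
Proof.
  intros cH B.
  assert (e : forall t, 0 <= t <= 1 ->
    Derive (fun u => t ^ m * H (t * x) u) y = t ^ m * dy H (t * x) y).
  { intros t Ht. apply is_derive_unique, ray_integrand_derive_y with (box d); auto.
    now apply box_scale. }
  unfold ray_integral at 2.
  rewrite <- (RInt_ext (fun t => Derive (fun u => t ^ m * H (t * x) u) y)).
  2:{ intros t Ht. rewrite Rmin_left, Rmax_right in Ht by lra. apply e; lra. }
  apply (is_derive_RInt_param (fun y t => t ^ m * H (t * x) y)).
  - apply filter_imp with (2 := locally_box_y d x y B). intros u Bu t Ht.
    rewrite Rmin_left, Rmax_right in Ht by lra.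
    exists (t ^ m * dy H (t * x) u). apply ray_integrand_derive_y with (box d); auto.
    now apply box_scale.
  - intros t Ht. rewrite Rmin_left, Rmax_right in Ht by lra.
    assert (Bt : box d (t * x) y) by now apply box_scale.
    apply continuity_2d_pt_ext_loc with (fun u v => v ^ m * dy H (v * x) u).
    + apply locally_2d_impl with (fun u v => box d (v * x) u).
      * apply locally_2d_forall. intros u v Buv. symmetry.
        apply is_derive_unique, ray_integrand_derive_y with (box d); auto.
      * apply (locally_2d_comp (box d) (fun u v => v * x) (fun u _ => u)).
        -- now apply open2_box.
        -- apply continuity_2d_pt_mult;
             [apply continuity_2d_pt_id2|apply continuity_2d_pt_const].
        -- apply continuity_2d_pt_id1.
    + apply ray_integrand_continuity_y, Cn_continuity with (box d) 0%nat; auto.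
      now apply Cn_dy.
  - apply filter_imp with (2 := locally_box_y d x y B). intros u Bu.
    apply ray_integrable with d; auto. apply Cn_le with 1%nat; auto.
Qed.

(** [H] is uniformly continuous near the segment swept by [t * x], and the weight is at most 1, so
    the integrands at neighbouring points are uniformly close. *)
Lemma ray_integral_continuity d m H x y :
  Cn (box d) 0 H -> box d x y -> continuity_2d_pt (ray_integral m H) x y.
Proof.
  intros cH B eps. pose proof B as [Bx By].
  (* The midpoint between [Rabs x] and [d]: the segment from [- a] to [a] stays inside the box and
     still contains [t * u] for all [u] near [x]. *)
  set (a := (Rabs x + d) / 2).
  assert (e2 : 0 < eps / 2) by (apply is_pos_div_2).
  destruct (uniform_continuity_2d_1d H (- a) a y) with (mkposreal _ e2) as [del Hdel].
  { intros z Hz. apply Cn_continuity with (box d) 0%nat; auto. split; auto.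
    apply Rabs_lt_between. unfold a in Hz. lra. }
  simpl in Hdel.
  assert (p : 0 < (d - Rabs x) / 2) by lra.
  destruct (open2_box d x y B) as [d2 Hd2].
  set (dd := Rmin (Rmin del d2) ((d - Rabs x) / 2)).
  assert (pd : 0 < dd).
  { repeat apply Rmin_pos; try apply cond_pos. lra. }
  exists (mkposreal dd pd). simpl. intros u v Hu Hv.
  assert (d1 : dd <= del) by (eapply Rle_trans; [apply Rmin_l|apply Rmin_l]).
  assert (d3 : dd <= d2) by (eapply Rle_trans; [apply Rmin_l|apply Rmin_r]).
  assert (d4 : dd <= (d - Rabs x) / 2) by apply Rmin_r.
  assert (Buv : box d u v) by (apply Hd2; lra).
  unfold ray_integral.
  pose proof (ray_integrable d m H u v cH Buv) as iu.
  pose proof (ray_integrable d m H x y cH B) as ix.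
  change (Rabs (minus (RInt (fun t => t ^ m * H (t * u) v) 0 1)
                      (RInt (fun t => t ^ m * H (t * x) y) 0 1)) < eps).
  rewrite <- (RInt_minus (V := R_CompleteNormedModule)) by assumption.
  apply Rle_lt_trans with ((1 - 0) * (eps / 2)); [|lra].
  apply abs_RInt_le_const; [lra| |].
  { apply (ex_RInt_minus (V := R_NormedModule)); assumption. }
  intros t Ht. unfold minus, plus, opp; simpl.
  replace (t ^ m * H (t * u) v + - (t ^ m * H (t * x) y))
    with (t ^ m * (H (t * u) v - H (t * x) y)) by ring.
  assert (0 <= t ^ m <= 1).
  { split; [apply pow_le; lra|]. rewrite <- (pow1 m). apply pow_incr. lra. }
  rewrite Rabs_mult, (Rabs_pos_eq (t ^ m)) by lra.
  assert (HH : Rabs (H (t * u) v - H (t * x) y) < eps / 2).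
  { pose proof (Rabs_triang (u - x) x) as T. replace (u - x + x) with u in T by ring.
    assert (Ab : forall z, Rabs z <= a -> - a <= t * z <= a).
    { intros z Hz. apply Rabs_le_between. rewrite Rabs_mult, (Rabs_pos_eq t) by lra.
      pose proof (Rabs_pos z). nra. }
    pose proof (cond_pos del).
    apply Hdel.
    - apply Ab. unfold a. lra.
    - lra.
    - apply Ab. unfold a. lra.
    - apply Rabs_lt_between in Hv. lra.
    - replace (t * u - t * x) with (t * (u - x)) by ring.
      rewrite Rabs_mult, (Rabs_pos_eq t) by lra. pose proof (Rabs_pos (u - x)). nra. }
  pose proof (Rabs_pos (H (t * u) v - H (t * x) y)). nra.
Qed.

Lemma ray_integral_Cn d n m H : Cn (box d) n H -> Cn (box d) n (ray_integral m H).
Proof.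
  revert m H. induction n as [|n IH]; intros m H cH.
  - intros x y B. split; [|exact I]. now apply ray_integral_continuity with d.
  - assert (Cn (box d) 1 H) by (apply Cn_le with (S n); [lia|auto]).
    apply Cn_intro_partial with (ray_integral (S m) (dx H)) (ray_integral m (dy H)).
    + apply open2_box.
    + intros x y. now apply ray_integral_derive_x.
    + intros x y. now apply ray_integral_derive_y.
    + now apply IH, Cn_dx.
    + now apply IH, Cn_dy.
Qed.

(** The fundamental theorem of calculus for [H (t * x) y] between [t = 0] and [t = 1]. *)
Lemma ray_integral_dx d H x y :
  Cn (box d) 1 H -> box d x y -> H x y = H 0 y + x * ray_integral 0 (dx H) x y.
Proof.
  intros cH B. unfold ray_integral.
  assert (E : RInt (fun t => x * (t ^ 0 * dx H (t * x) y)) 0 1 = H x y - H 0 y).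
  { replace (H x y - H 0 y) with (minus (H (1 * x) y) (H (0 * x) y)).
    2:{ unfold minus, plus, opp; simpl. rewrite Rmult_1_l, Rmult_0_l. reflexivity. }
    apply is_RInt_unique.
    apply (is_RInt_derive (fun t => H (t * x) y)).
    - intros t Ht. rewrite Rmin_left, Rmax_right in Ht by lra.
      replace (x * (t ^ 0 * dx H (t * x) y)) with (x * dx H (t * x) y) by (simpl; ring).
      apply (is_derive_comp (fun z => H z y) (fun u => u * x)).
      + apply Derive_correct, (cH (t * x) y). now apply box_scale.
      + auto_derive; [exact I|ring].
    - intros t Ht. rewrite Rmin_left, Rmax_right in Ht by lra.
      apply (continuity_2d_pt_snd_slice (fun u v => x * (v ^ 0 * dx H (v * u) y))).
      apply continuity_2d_pt_mult; [apply continuity_2d_pt_const|].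
      apply ray_integrand_continuity_x, Cn_continuity with (box d) 0%nat.
      + now apply Cn_dx.
      + now apply box_scale. }
  rewrite (RInt_scal (V := R_CompleteNormedModule)) in E.
  - change (x * RInt (fun t => t ^ 0 * dx H (t * x) y) 0 1 = H x y - H 0 y) in E. lra.
  - apply ray_integrable with d; auto. now apply Cn_dx.
Qed.

(** * Smooth germs and Hadamard's lemma *)

Lemma box_le d e x y : d <= e -> box d x y -> box e x y.
Proof. intros le [Hx Hy]. split; lra. Qed.

Lemma locally_2d_box (P : R -> R -> Prop) :
  locally_2d P 0 0 <-> exists d, 0 < d /\ forall x y, box d x y -> P x y.
Proof.
  split.
  - intros [d Hd]. exists d. split; [apply cond_pos|]. intros x y [Hx Hy].
    apply Hd; now rewrite Rminus_0_r.
  - intros [d [pd Hd]]. exists (mkposreal d pd). intros x y Hx Hy.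
    rewrite Rminus_0_r in Hx, Hy. now apply Hd.
Qed.

Lemma smooth_germ_box F :
  smooth_germ F <-> exists d, 0 < d /\ smooth_on (box d) F.
Proof.
  unfold smooth_germ. rewrite locally_2d_box.
  split; intros [d [pd Hd]]; exists d; split; auto.
  - intros n x y B. now apply Hd.
  - intros x y B n. now apply Hd.
Qed.

Lemma smooth_germ_open U F : open2 U -> U 0 0 -> smooth_on U F -> smooth_germ F.
Proof.
  intros oU U0 HF. apply locally_2d_impl with U; [|now apply oU].
  apply locally_2d_forall. intros x y Uxy n. now apply HF.
Qed.

Lemma smooth_germ_continuity F : smooth_germ F -> continuity_2d_pt F 0 0.
Proof. intros HF. now destruct (locally_2d_singleton _ _ _ HF 0%nat). Qed.

Lemma box_0 d : 0 < d -> box d 0 0.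
Proof. intros pd. split; now rewrite Rabs_R0. Qed.

Lemma smooth_germ2_box F G :
  smooth_germ F -> smooth_germ G ->
  exists d, 0 < d /\ smooth_on (box d) F /\ smooth_on (box d) G.
Proof.
  rewrite !smooth_germ_box. intros [d [pd HF]] [e [pe HG]].
  exists (Rmin d e). split; [now apply Rmin_pos|].
  split; intros n; [apply Cn_sub with (box d)|apply Cn_sub with (box e)]; auto;
    intros x y; apply box_le; [apply Rmin_l|apply Rmin_r].
Qed.

Lemma smooth_germ_const k : smooth_germ (fun _ _ => k).
Proof.
  apply smooth_germ_open with (box 1); auto using open2_box, box_0, Rlt_0_1.
  intros n. apply Cn_const, open2_box.
Qed.

Lemma smooth_germ_fst : smooth_germ (fun x _ => x).
Proof.
  apply smooth_germ_open with (box 1); auto using open2_box, box_0, Rlt_0_1.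
  intros n. apply Cn_fst, open2_box.
Qed.

Lemma smooth_germ_snd : smooth_germ (fun _ y => y).
Proof.
  apply smooth_germ_open with (box 1); auto using open2_box, box_0, Rlt_0_1.
  intros n. apply Cn_snd, open2_box.
Qed.

Lemma smooth_germ_plus F G :
  smooth_germ F -> smooth_germ G -> smooth_germ (fun x y => F x y + G x y).
Proof.
  intros HF HG. destruct (smooth_germ2_box F G HF HG) as [d [pd [HF' HG']]].
  apply smooth_germ_open with (box d); auto using open2_box, box_0.
  intros n. apply Cn_plus; auto using open2_box.
Qed.

Lemma smooth_germ_mult F G :
  smooth_germ F -> smooth_germ G -> smooth_germ (fun x y => F x y * G x y).
Proof.
  intros HF HG. destruct (smooth_germ2_box F G HF HG) as [d [pd [HF' HG']]].
  apply smooth_germ_open with (box d); auto using open2_box, box_0.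
  intros n. apply Cn_mult; auto using open2_box.
Qed.

Lemma smooth_germ_pow F k : smooth_germ F -> smooth_germ (fun x y => F x y ^ k).
Proof.
  intros HF. induction k as [|k IH]; simpl;
    auto using smooth_germ_const, smooth_germ_mult.
Qed.

Lemma smooth_germ_dx F : smooth_germ F -> smooth_germ (dx F).
Proof.
  rewrite !smooth_germ_box. intros [d [pd HF]]. exists d. split; auto.
  intros n. apply Cn_dx, HF.
Qed.

(** Supplies the domain of a composite of germs: the points that the inner maps send into the domain
    of the outer one. *)
Lemma open2_preimage U V P Q :
  open2 U -> open2 V -> Cn U 0 P -> Cn U 0 Q ->
  open2 (fun x y => U x y /\ V (P x y) (Q x y)).
Proof.
  intros oU oV cP cQ x y [Uxy Vxy]. apply locally_2d_and; [now apply oU|].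
  apply locally_2d_comp; [now apply oV| |]; now apply Cn_continuity with U 0%nat.
Qed.

Lemma smooth_germ_comp F P Q :
  smooth_germ F -> smooth_germ P -> smooth_germ Q -> P 0 0 = 0 -> Q 0 0 = 0 ->
  smooth_germ (fun x y => F (P x y) (Q x y)).
Proof.
  intros HF HP HQ P0 Q0. destruct (smooth_germ2_box P Q HP HQ) as [d [pd [HP' HQ']]].
  apply smooth_germ_box in HF. destruct HF as [e [pe HF]].
  set (W := fun x y => box d x y /\ box e (P x y) (Q x y)).
  assert (oW : open2 W) by (apply open2_preimage; auto using open2_box).
  apply smooth_germ_open with W; auto.
  - split; [now apply box_0|]. rewrite P0, Q0. now apply box_0.
  - intros n. apply Cn_comp with (box e); auto using open2_box.
    + intros x y H. apply H.
    + apply Cn_sub with (box d); auto. intros x y H. apply H.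
    + apply Cn_sub with (box d); auto. intros x y H. apply H.
Qed.

Lemma smooth_germ_swap F : smooth_germ F -> smooth_germ (fun x y => F y x).
Proof.
  intros HF. apply (smooth_germ_comp F (fun _ y => y) (fun x _ => x));
    auto using smooth_germ_fst, smooth_germ_snd.
Qed.

Lemma smooth_germ_slice F : smooth_germ F -> smooth_germ (fun _ y => F 0 y).
Proof.
  intros HF. apply (smooth_germ_comp F (fun _ _ => 0) (fun _ y => y));
    auto using smooth_germ_const, smooth_germ_snd.
Qed.

Lemma continuity_2d_pt_pos F x y :
  continuity_2d_pt F x y -> 0 < F x y -> locally_2d (fun u v => 0 < F u v) x y.
Proof.
  intros cF pF. destruct (cF (mkposreal _ pF)) as [d Hd]. exists d.
  intros u v Hu Hv. specialize (Hd u v Hu Hv). simpl in Hd.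
  apply Rabs_lt_between in Hd. lra.
Qed.

Lemma smooth_germ_pos_box F :
  smooth_germ F -> 0 < F 0 0 ->
  exists d, 0 < d /\ smooth_on (box d) F /\ forall x y, box d x y -> 0 < F x y.
Proof.
  intros HF pF.
  pose proof (continuity_2d_pt_pos F 0 0 (smooth_germ_continuity F HF) pF) as L.
  apply locally_2d_box in L. destruct L as [e [pe He]].
  apply smooth_germ_box in HF. destruct HF as [d [pd Hd]].
  exists (Rmin d e). split; [now apply Rmin_pos|]. split.
  - intros n. apply Cn_sub with (box d); auto.
    intros x y. apply box_le, Rmin_l.
  - intros x y B. apply He. apply box_le with (2 := B), Rmin_r.
Qed.

Lemma smooth_germ_Rpower F a :
  smooth_germ F -> 0 < F 0 0 -> smooth_germ (fun x y => Rpower (F x y) a).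
Proof.
  intros HF pF. destruct (smooth_germ_pos_box F HF pF) as [d [pd [HF' pF']]].
  apply smooth_germ_open with (box d); auto using open2_box, box_0.
  intros n. apply Cn_Rpower_comp; auto using open2_box.
Qed.

(** The value of [G] on the line [x = 0] is recorded because the coefficient of [x] in the remainder
    is expanded further along that line. *)
Lemma hadamard_x F :
  smooth_germ F ->
  exists G, smooth_germ G /\ (forall y, G 0 y = dx F 0 y) /\
    locally_2d (fun x y => F x y = F 0 y + x * G x y) 0 0.
Proof.
  intros HF. apply smooth_germ_box in HF. destruct HF as [d [pd HF]].
  exists (ray_integral 0 (dx F)). repeat split.
  - apply smooth_germ_open with (box d); auto using open2_box, box_0.
    intros n. apply ray_integral_Cn, Cn_dx, HF.
  - intros y. unfold ray_integral.
    rewrite (RInt_ext _ (fun _ => dx F 0 y)).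
    2:{ intros t _. rewrite Rmult_0_r. simpl. ring. }
    rewrite RInt_const. change ((1 - 0) * dx F 0 y = dx F 0 y). ring.
  - apply locally_2d_box. exists d. split; auto. intros x y B.
    apply ray_integral_dx with d; auto.
Qed.

Lemma locally_2d_swap (P : R -> R -> Prop) x y :
  locally_2d P x y -> locally_2d (fun u v => P v u) y x.
Proof. intros [d Hd]. exists d. auto. Qed.

Lemma hadamard_y F :
  smooth_germ F ->
  exists G, smooth_germ G /\
    locally_2d (fun x y => F x y = F x 0 + y * G x y) 0 0.
Proof.
  intros HF.
  destruct (hadamard_x (fun x y => F y x) (smooth_germ_swap F HF)) as [G [HG [_ E]]].
  exists (fun x y => G y x). split; [now apply smooth_germ_swap|].
  now apply (locally_2d_swap (fun x y => F y x = F y 0 + x * G x y)).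
Qed.

Lemma smooth_germ_Derive_n_y F :
  smooth_germ F ->
  exists d, 0 < d /\ forall n y, Rabs y < d -> ex_derive (Derive_n (fun z => F 0 z) n) y.
Proof.
  intros HF. apply smooth_germ_box in HF. destruct HF as [d [pd HF]].
  exists d. split; auto. intros n y Hy.
  apply (ex_diff_n_ex_deriv_inf_2 (S n) 0 n ltac:(lia) F 0 y).
  apply HF. split; [now rewrite Rabs_R0|auto].
Qed.

(** Leibniz's rule, reduced to two terms because one factor is linear. Differentiability on a whole
    interval allows the formula itself to be differentiated in the induction. *)
Lemma Derive_n_mult_id g d n y :
  (forall n y, Rabs y < d -> ex_derive (Derive_n g n) y) -> Rabs y < d ->
  Derive_n (fun z => z * g z) (S n) y = y * Derive_n g (S n) y + INR (S n) * Derive_n g n y.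
Proof.
  intros Hg. revert y. induction n as [|n IH]; intros y Hy.
  - change (Derive (fun z => z * g z) y = y * Derive g y + 1 * g y).
    apply is_derive_unique. specialize (Hg 0%nat y Hy). simpl in Hg.
    auto_derive; [exact Hg|]. change (Derive (fun x => g x) y) with (Derive g y). ring.
  - change (Derive (Derive_n (fun z => z * g z) (S n)) y =
      y * Derive_n g (S (S n)) y + INR (S (S n)) * Derive_n g (S n) y).
    rewrite (Derive_ext_loc _
      (fun z => z * Derive_n g (S n) z + INR (S n) * Derive_n g n z)).
    + apply is_derive_unique.
      pose proof (Hg (S n) y Hy) as H1. pose proof (Hg n y Hy) as H2.
      rewrite (S_INR (S n)). generalize (INR (S n)). intros k.
      change (Derive_n g (S (S n)) y) with (Derive (Derive_n g (S n)) y).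
      assert (e : Derive (Derive_n g n) y = Derive_n g (S n) y) by reflexivity.
      revert H1 H2 e. generalize (Derive_n g (S n)) (Derive_n g n). intros g1 g0 H1 H2 e.
      auto_derive; [now split|].
      change (Derive (fun x => g1 x) y) with (Derive g1 y).
      change (Derive (fun x => g0 x) y) with (Derive g0 y). rewrite e. ring.
    + assert (p : 0 < d - Rabs y) by lra. exists (mkposreal _ p). intros z Hz.
      apply IH. unfold ball in Hz; simpl in Hz; unfold AbsRing_ball in Hz.
      change (Rabs (z - y) < d - Rabs y) in Hz.
      pose proof (Rabs_triang_inv z y) as T. lra.
Qed.

(** At the origin the first Leibniz term disappears, so division by [y] shifts the derivatives by
    one order, up to the factor [INR (S n)]. *)
Lemma Derive_n_factor_y F G n :
  smooth_germ G -> locally 0 (fun y => F y = y * G 0 y) ->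
  Derive_n F (S n) 0 = INR (S n) * Derive_n (fun y => G 0 y) n 0.
Proof.
  intros HG E. rewrite (Derive_n_ext_loc _ (fun y => y * G 0 y)); auto.
  destruct (smooth_germ_Derive_n_y G HG) as [d [pd Hd]].
  rewrite (Derive_n_mult_id (fun y => G 0 y) d); auto; [ring|now rewrite Rabs_R0].
Qed.

(** Each Hadamard quotient by [y] inherits the vanishing derivatives, one order lower, so the
    division can be repeated [k] times. *)
Lemma taylor_y F k :
  smooth_germ F -> (forall i, (i < k)%nat -> Derive_n (fun y => F 0 y) i 0 = 0) ->
  exists E, smooth_germ E /\ locally_2d (fun x y => F 0 y = y ^ k * E x y) 0 0.
Proof.
  revert F. induction k as [|k IH]; intros F HF Z.
  - exists (fun _ y => F 0 y). split; [now apply smooth_germ_slice|].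
    apply locally_2d_forall. intros x y. simpl. ring.
  - destruct (hadamard_y F HF) as [G [HG E]].
    assert (F0 : F 0 0 = 0) by (apply (Z 0%nat); lia).
    apply locally_2d_1d_const_x in E.
    assert (E' : locally 0 (fun y => F 0 y = y * G 0 y)).
    { apply filter_imp with (2 := E). intros y ->. rewrite F0. ring. }
    destruct (IH G HG) as [H [HH E2]].
    { intros i Hi. apply Rmult_eq_reg_l with (INR (S i)); [|apply not_0_INR; lia].
      rewrite <- (Derive_n_factor_y (fun y => F 0 y)); auto.
      rewrite Rmult_0_r. apply Z. lia. }
    exists H. split; auto.
    apply locally_2d_impl with (2 := E2).
    destruct E' as [d Hd]. exists d. intros x y _ Hy e.
    rewrite (Hd y Hy), e. simpl. ring.
Qed.

(** Two Hadamard steps in [x] leave coefficients of [1] and [x] that are functions of [y] alone,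
    which [taylor_y] divides by [y ^ 4] and [y ^ 2]; the rest is divisible by [x ^ 2]. *)
Lemma taylor_remainder_factor r :
  smooth_germ r -> order_ge 4 r ->
  exists E0 E1 E2, smooth_germ E0 /\ smooth_germ E1 /\ smooth_germ E2 /\ E2 0 0 = 0 /\
    locally_2d (fun x y => r x y = y ^ 4 * E0 x y + x * y ^ 2 * E1 x y + x ^ 2 * E2 x y) 0 0.
Proof.
  intros Hr Or.
  assert (Hrx := smooth_germ_dx r Hr).
  destruct (taylor_y r 4 Hr) as [E0 [HE0 e0]].
  { intros i Hi. apply (Or 0%nat i). lia. }
  destruct (taylor_y (dx r) 2 Hrx) as [E1 [HE1 e1]].
  { intros i Hi. change (partial_derive 0 i (partial_derive 1 0 r) 0 0 = 0).
    (* [partial_derive 1 i] differentiates in [y] before [x], whereas here [x] comes first;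
       smoothness lets the two commute. *)
    rewrite <- Derive_partial_derive_aux1; [apply Or; lia|].
    apply locally_2d_impl with (2 := Hr). apply locally_2d_forall. auto. }
  destruct (hadamard_x r Hr) as [G1 [HG1 [G1x e2]]].
  destruct (hadamard_x G1 HG1) as [E2 [HE2 [_ e3]]].
  exists E0, E1, E2. repeat split; auto.
  - assert (r0 : r 0 0 = 0) by (apply (Or 0%nat 0%nat); lia).
    assert (rx0 : dx r 0 0 = 0) by (apply (Or 1%nat 0%nat); lia).
    (* Each of the two divisions by [x] contributes one factor: the second derivative of [r] in [x]
       is [2 * 1] times [E2] at the origin. *)
    apply Rmult_eq_reg_l with (INR 2 * INR 1); [|simpl; lra].
    rewrite Rmult_0_r, Rmult_assoc.
    transitivity (partial_derive 2 0 r 0 0); [|apply Or; lia].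
    change (E2 0 0) with (Derive_n (fun y => E2 y 0) 0 0).
    pose proof (locally_2d_1d_const_y _ _ _ e2) as l2.
    pose proof (locally_2d_1d_const_y _ _ _ e3) as l3.
    rewrite <- (Derive_n_factor_y (fun y => G1 y 0) (fun x y => E2 y x)).
    + rewrite <- (Derive_n_factor_y (fun y => r y 0) (fun x y => G1 y x)).
      * reflexivity.
      * now apply smooth_germ_swap.
      * apply filter_imp with (2 := l2). intros x ->. rewrite r0. ring.
    + now apply smooth_germ_swap.
    + apply filter_imp with (2 := l3). intros x ->. rewrite G1x, rx0. ring.
  - apply locally_2d_impl with (2 := e0), locally_2d_impl with (2 := e1),
      locally_2d_impl with (2 := e2), locally_2d_impl with (2 := e3).
    apply locally_2d_forall. intros x y h3 h2 h1 h0.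
    rewrite h2, h3, h0, G1x, h1. ring.
Qed.

(** * Local inversion and the A2 normal form *)

(** Dividing the linearisation of [F] at [(X u y, y)] by [a] gives that of [X], but with an error
    measured in the increment of [X] itself; this increment must first be bounded by those of [u]
    and [y]. *)
Lemma implicit_differentiable F X u y a b :
  0 < a -> differentiable_pt_lim F (X u y) y a b ->
  continuity_2d_pt X u y ->
  locally_2d (fun u' y' => F (X u' y') y' = u') u y ->
  differentiable_pt_lim X u y (/ a) (- b * / a).
Proof.
  intros pa DF cX EF eps.
  pose proof (cond_pos eps) as peps.
  (* The Lipschitz bound for [X] at the point: with [e <= a / 2], half of [a * Rabs s] absorbs the
     error [e * Rabs s] and leaves [a / 2 * Rabs s <= (1 + Rabs b + a / 2) * M]. The other bound on
     [e] brings the final error [e * (K * M + M)] below [eps * a * M]. *)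
  set (K := 2 / a * (1 + Rabs b + a / 2)).
  assert (pb := Rabs_pos b).
  assert (pK : 0 < K).
  { apply Rmult_lt_0_compat; [apply Rdiv_lt_0_compat; lra|lra]. }
  assert (pe : 0 < Rmin (a / 2) (eps * a / (K + 1))).
  { apply Rmin_pos; [lra|]. apply Rdiv_lt_0_compat; nra. }
  set (e := mkposreal _ pe).
  assert (e1 : e <= a / 2) by apply Rmin_l.
  assert (e2 : e * (K + 1) <= eps * a).
  { apply Rle_trans with (eps * a / (K + 1) * (K + 1)).
    - apply Rmult_le_compat_r; [lra|apply Rmin_r].
    - right. field. lra. }
  assert (e0 : 0 < e) by apply cond_pos.
  assert (L : locally_2d (fun u' y' =>
    Rabs (F (X u' y') y' - F (X u y) y - (a * (X u' y' - X u y) + b * (y' - y)))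
      <= e * Rmax (Rabs (X u' y' - X u y)) (Rabs (y' - y))) u y).
  { apply (locally_2d_comp (fun x v =>
      Rabs (F x v - F (X u y) y - (a * (x - X u y) + b * (v - y)))
      <= e * Rmax (Rabs (x - X u y)) (Rabs (v - y))) X (fun _ v => v)).
    - apply DF.
    - exact cX.
    - apply continuity_2d_pt_id2. }
  assert (E0 := locally_2d_singleton _ _ _ EF). simpl in E0.
  apply locally_2d_impl with (2 := L), locally_2d_impl with (2 := EF).
  apply locally_2d_forall. intros u' y' EF' L'. rewrite EF', E0 in L'.
  set (s := X u' y' - X u y) in *.
  set (M := Rmax (Rabs (u' - u)) (Rabs (y' - y))).
  assert (M1 : Rabs (u' - u) <= M) by apply Rmax_l.
  assert (M2 : Rabs (y' - y) <= M) by apply Rmax_r.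
  assert (M0 : 0 <= M) by (pose proof (Rabs_pos (u' - u)); lra).
  assert (Ls : Rmax (Rabs s) (Rabs (y' - y)) <= Rabs s + M).
  { apply Rmax_lub; pose proof (Rabs_pos s); lra. }
  assert (sb : Rabs s <= K * M).
  { assert (T : a * Rabs s <= (1 + Rabs b) * M + e * (Rabs s + M)).
    { rewrite <- (Rabs_pos_eq a) at 1 by lra. rewrite <- Rabs_mult.
      replace (a * s) with ((u' - u) - b * (y' - y) - (u' - u - (a * s + b * (y' - y)))) by ring.
      eapply Rle_trans; [apply Rabs_triang|]. rewrite Rabs_Ropp.
      apply Rplus_le_compat.
      - eapply Rle_trans; [apply Rabs_triang|]. rewrite Rabs_Ropp, Rabs_mult.
        rewrite Rmult_plus_distr_r, Rmult_1_l. apply Rplus_le_compat; auto.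
        now apply Rmult_le_compat_l.
      - eapply Rle_trans; [exact L'|]. apply Rmult_le_compat_l; lra. }
    pose proof (Rabs_pos s).
    assert (T2 : a / 2 * Rabs s <= (1 + Rabs b + a / 2) * M) by nra.
    unfold K. apply Rmult_le_reg_l with (a / 2); [lra|].
    replace (a / 2 * (2 / a * (1 + Rabs b + a / 2) * M))
      with ((1 + Rabs b + a / 2) * M) by (field; lra). exact T2. }
  replace (s - (/ a * (u' - u) + - b * / a * (y' - y)))
    with (- / a * (u' - u - (a * s + b * (y' - y)))) by (field; lra).
  rewrite Rabs_mult, Rabs_Ropp, (Rabs_pos_eq (/ a)) by (left; apply Rinv_0_lt_compat; lra).
  apply Rmult_le_reg_l with a; [lra|]. rewrite <- Rmult_assoc, Rinv_r, Rmult_1_l by lra.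
  eapply Rle_trans; [exact L'|].
  apply Rle_trans with (e * (K * M + M)).
  - apply Rmult_le_compat_l; lra.
  - nra.
Qed.

(** [F] increases in its first variable, so the intermediate value theorem solves [F x y = u], and
    monotonicity makes the root unique and continuous. Regularity then climbs by itself: the
    partials of [X] are $1/F_x$ and $-F_y/F_x$ at [(X u y, y)], of class $C^n$ as soon as [X] is. *)
Lemma implicit_function F :
  smooth_germ F -> F 0 0 = 0 -> 0 < dx F 0 0 ->
  exists X, smooth_germ X /\ X 0 0 = 0 /\
    locally_2d (fun u y => F (X u y) y = u) 0 0 /\
    locally_2d (fun x y => X (F x y) y = x) 0 0.
Proof.
  intros HF F0 Fx0.
  destruct (smooth_germ_pos_box (dx F) (smooth_germ_dx F HF) Fx0) as [d1 [pd1 [_ Fx]]].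
  apply smooth_germ_box in HF. destruct HF as [d2 [pd2 HF]].
  set (d := Rmin d1 d2). assert (pd : 0 < d) by now apply Rmin_pos.
  assert (dd1 : d <= d1) by apply Rmin_l. assert (dd2 : d <= d2) by apply Rmin_r.
  assert (HF' : smooth_on (box d) F).
  { intros n. apply Cn_sub with (box d2); auto. intros x y. now apply box_le. }
  assert (Fx' : forall x y, box d x y -> 0 < dx F x y).
  { intros x y B. apply Fx. now apply box_le with d. }
  clear HF Fx. rename HF' into HF, Fx' into Fx.
  assert (cF : forall x y, box d x y -> continuity_2d_pt F x y).
  { intros x y. now apply Cn_continuity with 0%nat. }
  assert (mono : forall x1 x2 y, Rabs y < d -> - d < x1 -> x1 < x2 -> x2 < d -> F x1 y < F x2 y).
  { intros x1 x2 y Hy H1 H12 H2.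
    apply (incr_function (fun x => F x y) (- d) d (fun x => dx F x y)); auto.
    - intros x Hx1 Hx2. apply Derive_correct.
      destruct (HF 1%nat x y) as [_ [D _]]; auto. split; auto.
      apply Rabs_lt_between. auto.
    - intros x Hx1 Hx2. apply Fx. split; auto. apply Rabs_lt_between. auto. }
  (* The closed interval from [- l] to [l] lies inside the box, so continuity and monotonicity hold
     up to its endpoints. *)
  set (l := d / 2).
  assert (Fl : 0 < F l 0).
  { assert (H := mono 0 l 0). rewrite F0, Rabs_R0 in H. apply H; unfold l; lra. }
  assert (Fm : F (- l) 0 < 0).
  { assert (H := mono (- l) 0 0). rewrite F0, Rabs_R0 in H. apply H; unfold l; lra. }
  assert (slice : forall x y, box d x y ->
    forall u, continuity_2d_pt (fun _ y' => F x y') u y).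
  { intros x y B u. apply (continuity_2d_pt_comp F (fun _ _ => x) (fun _ y' => y')).
    - now apply cF.
    - apply continuity_2d_pt_const.
    - apply continuity_2d_pt_id2. }
  (* For fixed [x], comparing [F x y] with [u] is an open condition on [(u, y)]. This keeps a
     bracket of the root valid nearby, both for the bracket [- l], [l] and for the tight one that
     proves continuity. *)
  assert (below : forall x u y, box d x y -> F x y < u ->
    locally_2d (fun u' y' => F x y' < u') u y).
  { intros x u y B H.
    apply locally_2d_impl with (fun u' y' => 0 < u' - F x y').
    - apply locally_2d_forall. intros; lra.
    - apply (continuity_2d_pt_pos (fun u' y' => u' - F x y')); [|lra].
      apply continuity_2d_pt_minus; [apply continuity_2d_pt_id1|now apply slice]. }
  assert (above : forall x u y, box d x y -> u < F x y ->
    locally_2d (fun u' y' => u' < F x y') u y).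
  { intros x u y B H.
    apply locally_2d_impl with (fun u' y' => 0 < F x y' - u').
    - apply locally_2d_forall. intros; lra.
    - apply (continuity_2d_pt_pos (fun u' y' => F x y' - u')); [|lra].
      apply continuity_2d_pt_minus; [now apply slice|apply continuity_2d_pt_id1]. }
  assert (bl : forall x y, - l <= x <= l -> Rabs y < d -> box d x y).
  { intros x y Hx Hy. split; auto. apply Rabs_lt_between. unfold l in Hx. lra. }
  assert (L : locally_2d (fun u y => Rabs y < d /\ F (- l) y < u /\ u < F l y) 0 0).
  { apply locally_2d_and; [|apply locally_2d_and].
    - apply locally_2d_box. exists d. split; auto. intros x y B. apply B.
    - apply below; auto. apply bl; [unfold l; lra|now rewrite Rabs_R0].
    - apply above; auto. apply bl; [unfold l; lra|now rewrite Rabs_R0]. }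
  apply locally_2d_box in L. destruct L as [e [pe He]].
  assert (ex : forall u y, box e u y -> exists x, - l < x < l /\ F x y = u).
  { intros u y B. destruct (He u y B) as [Hy [H1 H2]].
    destruct (Ranalysis5.IVT_interv (fun x => F x y - u) (- l) l) as [z [Hz Ez]].
    - intros x Hx. apply continuity_pt_minus; [|apply continuity_pt_const; now intros ? ?].
      apply continuity_pt_filterlim.
      apply (continuity_2d_pt_snd_slice (fun y x => F x y)).
      intros eps. apply (locally_2d_swap (fun a b => Rabs (F a b - F x y) < eps)).
      apply cF. now apply bl.
    - unfold l; lra.
    - lra.
    - lra.
    - exists z. assert (F z y = u) by lra. split; auto.
      assert (z <> - l) by (intros ->; lra). assert (z <> l) by (intros ->; lra). lra. }
  (* [X] is a total function; the existence of a root makes its value meaningful on [box e]. *)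
  set (X := fun u y => epsilon (inhabits 0) (fun x => - l < x < l /\ F x y = u)).
  assert (HX : forall u y, box e u y -> - l < X u y < l /\ F (X u y) y = u).
  { intros u y B. apply (epsilon_spec (inhabits 0) (fun x => - l < x < l /\ F x y = u)).
    now apply ex. }
  assert (uniq : forall x1 x2 y, Rabs y < d -> - l < x1 < l -> - l < x2 < l ->
    F x1 y = F x2 y -> x1 = x2).
  { intros x1 x2 y Hy H1 H2 E. unfold l in *.
    destruct (Rtotal_order x1 x2) as [H|[H|H]]; auto.
    - pose proof (mono x1 x2 y). lra.
    - pose proof (mono x2 x1 y). lra. }
  assert (cX : forall u y, box e u y -> continuity_2d_pt X u y).
  { intros u y B eps. destruct (HX u y B) as [[H1 H2] E]. destruct (He u y B) as [Hy _].
    (* Half the minimum keeps [x - t] and [x + t] strictly between [- l] and [l], where monotonicity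
       makes them bracket the nearby roots. *)
    set (x := X u y) in *. set (t := Rmin eps (Rmin (l - x) (x + l)) / 2).
    assert (pm : 0 < Rmin eps (Rmin (l - x) (x + l))).
    { repeat apply Rmin_pos; try lra. apply cond_pos. }
    assert (t1 : t < eps).
    { pose proof (Rmin_l eps (Rmin (l - x) (x + l))). unfold t. lra. }
    assert (t2 : t < l - x /\ t < x + l).
    { pose proof (Rmin_r eps (Rmin (l - x) (x + l))).
      pose proof (Rmin_l (l - x) (x + l)). pose proof (Rmin_r (l - x) (x + l)).
      unfold t. lra. }
    assert (t0 : 0 < t) by (unfold t; lra). clearbody t.
    assert (B1 : F (x - t) y < u).
    { rewrite <- E. apply mono; auto; unfold l in *; lra. }
    assert (B2 : u < F (x + t) y).
    { rewrite <- E at 1. apply mono; auto; unfold l in *; lra. }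
    apply below in B1; [|apply bl; lra]. apply above in B2; [|apply bl; lra].
    pose proof (open2_box e u y B) as B3.
    apply locally_2d_impl with (2 := B1), locally_2d_impl with (2 := B2),
      locally_2d_impl with (2 := B3).
    apply locally_2d_forall. intros u' y' Be A1 A2.
    destruct (HX u' y' Be) as [[H1' H2'] E']. destruct (He u' y' Be) as [Hy' _].
    apply Rabs_lt_between.
    assert (x - t < X u' y').
    { destruct (Rlt_le_dec (x - t) (X u' y')) as [|[H|H]]; auto; exfalso.
      - pose proof (mono (X u' y') (x - t) y'). unfold l in *. lra.
      - rewrite H in E'. lra. }
    assert (X u' y' < x + t).
    { destruct (Rlt_le_dec (X u' y') (x + t)) as [|[H'|H']]; auto; exfalso.
      - pose proof (mono (x + t) (X u' y') y'). unfold l in *. lra.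
      - rewrite <- H' in E'. lra. }
    lra. }
  assert (BX : forall u y, box e u y -> box d (X u y) y).
  { intros u y B. apply bl; [destruct (HX u y B); lra|apply (He u y B)]. }
  assert (SX : smooth_on (box e) X).
  { intros n. induction n as [|n IH].
    - intros u y B. split; [now apply cX|exact I].
    (* The reciprocal of $F_x$ is written as a power of exponent -1, whose regularity is already
       known. *)
    - assert (C1 : Cn (box e) n (fun u y => Rpower (dx F (X u y) y) (- (1)))).
      { apply Cn_Rpower_comp; auto using open2_box.
        apply (Cn_comp (box e) (box d) n (dx F) X (fun _ y => y)); auto using open2_box, Cn_snd.
        apply Cn_dx, HF. }
      apply Cn_intro with (fun u y => Rpower (dx F (X u y) y) (- (1)))
        (fun u y => -1 * dy F (X u y) y * Rpower (dx F (X u y) y) (- (1))); auto using open2_box.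
      + intros u y B. rewrite Rpower_Ropp, Rpower_1 by auto.
        replace (-1 * dy F (X u y) y) with (- dy F (X u y) y) by ring.
        apply implicit_differentiable with F; auto.
        * apply Cn_differentiable with (box d) 0%nat; auto using open2_box.
        * apply locally_2d_impl with (2 := open2_box e u y B).
          apply locally_2d_forall. intros u' y' B'. now apply HX.
      + apply Cn_mult; auto using open2_box.
        apply Cn_mult; auto using open2_box, Cn_const.
        apply (Cn_comp (box e) (box d) n (dy F) X (fun _ y => y)); auto using open2_box, Cn_snd.
        apply Cn_dy, HF. }
  exists X. split; [|split; [|split]].
  - apply smooth_germ_open with (box e); auto using open2_box, box_0.
  - destruct (HX 0 0 (box_0 e pe)) as [H E]. apply uniq with 0; auto.
    + now rewrite Rabs_R0.
    + unfold l; lra.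
    + now rewrite F0.
  - apply locally_2d_box. exists e. split; auto. intros u y B. now apply HX.
  - assert (B0 : box d 0 0) by now apply box_0.
    apply locally_2d_impl with (fun x y => box e (F x y) y).
    (* For [x] in the interval, [x] is itself a root for the value [F x y], so uniqueness identifies
       it with [X (F x y) y]. *)
    + apply locally_2d_box. exists l. split; [unfold l; lra|].
      intros x y [Hx Hy] B. destruct (HX _ _ B) as [H E].
      apply uniq with y; auto.
      * unfold l in Hy; lra.
      * now apply Rabs_lt_between.
    + apply (locally_2d_comp (box e) F (fun _ y => y)).
      * rewrite F0. now apply open2_box, box_0.
      * now apply cF.
      * apply continuity_2d_pt_id2.
Qed.

(** * Diffeomorphism germs and right equivalence *)

Lemma dx_mult_id S : smooth_germ S -> dx (fun x y => x * S x y) 0 0 = S 0 0.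
Proof.
  intros HS. destruct (locally_2d_singleton _ _ _ HS 1%nat) as [_ [D _]].
  apply is_derive_unique. auto_derive; [exact D|]. ring.
Qed.

(** A normal form is found by writing [g] as [k] in new coordinates, whereas [right_equiv g k]
    composes [g] with a diffeomorphism; the inverse passes from one to the other. *)
Lemma diffeo_germ_sym p1 p2 :
  diffeo_germ p1 p2 ->
  exists q1 q2, diffeo_germ q1 q2 /\
    locally_2d (fun x y => p1 (q1 x y) (q2 x y) = x /\ p2 (q1 x y) (q2 x y) = y) 0 0.
Proof.
  intros [H1 [H2 [H3 [H4 [q1 [q2 [H5 [H6 [H7 [H8 [H9 H10]]]]]]]]]]].
  exists q1, q2. split; auto. repeat split; auto.
  exists p1, p2. auto 8.
Qed.

Lemma locally_2d_germ_comp (P : R -> R -> Prop) p1 p2 :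
  smooth_germ p1 -> smooth_germ p2 -> p1 0 0 = 0 -> p2 0 0 = 0 ->
  locally_2d P 0 0 -> locally_2d (fun x y => P (p1 x y) (p2 x y)) 0 0.
Proof.
  intros H1 H2 E1 E2 L. apply locally_2d_comp; [|now apply smooth_germ_continuity..].
  now rewrite E1, E2.
Qed.

(* The shear (u(x, y), y) is inverted first; it carries y M to a function
   of the same shape, so that a second shear finishes. *)
Lemma diffeo_germ_triangular u M :
  smooth_germ u -> u 0 0 = 0 -> 0 < dx u 0 0 -> smooth_germ M -> 0 < M 0 0 ->
  diffeo_germ u (fun x y => y * M x y).
Proof.
  intros Hu u0 ux HM M0.
  destruct (implicit_function u Hu u0 ux) as [X [HX [X0 [EX1 EX2]]]].
  set (N := fun y u => M (X u y) y).
  assert (HN : smooth_germ N).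
  { apply (smooth_germ_swap (fun u y => M (X u y) y)).
    apply (smooth_germ_comp M X (fun _ y => y)); auto using smooth_germ_snd. }
  assert (N0 : N 0 0 = M 0 0) by (unfold N; now rewrite X0).
  destruct (implicit_function (fun y u => y * N y u)) as [Y [HY [Y0 [EY1 EY2]]]].
  - apply smooth_germ_mult; auto using smooth_germ_fst.
  - ring.
  - rewrite dx_mult_id, N0; auto.
  - assert (HY' : smooth_germ (fun u w => Y w u)) by now apply smooth_germ_swap.
    repeat split; auto.
    + apply smooth_germ_mult; auto using smooth_germ_snd.
    + ring.
    + exists (fun u w => X u (Y w u)), (fun u w => Y w u).
      repeat split; auto.
      * apply (smooth_germ_comp X (fun u _ => u) (fun u w => Y w u)); auto using smooth_germ_fst.
      * now rewrite Y0.
      * pose proof (locally_2d_germ_comp (fun y u => Y (y * N y u) u = y)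
          (fun _ y => y) u smooth_germ_snd Hu eq_refl u0 EY2) as E.
        apply locally_2d_impl with (2 := E), locally_2d_impl with (2 := EX2).
        apply locally_2d_forall. intros x y e1 e2. unfold N in e2.
        rewrite e1 in e2. now rewrite e2.
      * apply (locally_2d_swap (fun y u => Y y u * N (Y y u) u = y)) in EY1.
        apply locally_2d_and; [|exact EY1].
        apply (locally_2d_germ_comp (fun a b => u (X a b) b = a)
          (fun s _ => s) (fun s w => Y w s)); auto using smooth_germ_fst.
Qed.

Lemma diffeo_germ_comp p1 p2 q1 q2 :
  diffeo_germ p1 p2 -> diffeo_germ q1 q2 ->
  diffeo_germ (fun x y => p1 (q1 x y) (q2 x y)) (fun x y => p2 (q1 x y) (q2 x y)).
Proof.
  intros [A1 [A2 [A3 [A4 [a1 [a2 [A5 [A6 [A7 [A8 [A9 A10]]]]]]]]]]].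
  intros [B1 [B2 [B3 [B4 [b1 [b2 [B5 [B6 [B7 [B8 [B9 B10]]]]]]]]]]].
  split; [|split; [|split; [|split]]]; auto using smooth_germ_comp.
  1,2: now rewrite B3, B4.
  exists (fun x y => b1 (a1 x y) (a2 x y)), (fun x y => b2 (a1 x y) (a2 x y)).
  split; [|split; [|split; [|split; [|split]]]]; auto using smooth_germ_comp.
  1,2: now rewrite A7, A8.
  - pose proof (locally_2d_germ_comp _ _ _ B1 B2 B3 B4 A9) as L.
    apply locally_2d_impl with (2 := L), locally_2d_impl with (2 := B9).
    apply locally_2d_forall. intros x y [e1 e2] [e3 e4]. rewrite e3, e4. auto.
  - pose proof (locally_2d_germ_comp _ _ _ A5 A6 A7 A8 B10) as L.
    apply locally_2d_impl with (2 := L), locally_2d_impl with (2 := A10).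
    apply locally_2d_forall. intros x y [e1 e2] [e3 e4]. rewrite e3, e4. auto.
Qed.

Lemma is_sign_sqr s : is_sign s -> s * s = 1.
Proof. intros [-> | ->]; ring. Qed.

(** Exchanges the roles of the variables between $\pm y^3\pm x^2$ and $\pm(y^2+x^3)$; the sign on
    one coordinate adjusts the odd power. *)
Lemma diffeo_germ_swap_sign s :
  is_sign s -> diffeo_germ (fun _ y => y) (fun x _ => s * x).
Proof.
  intros Hs. assert (E := is_sign_sqr s Hs).
  repeat split; auto using smooth_germ_snd, smooth_germ_mult, smooth_germ_const, smooth_germ_fst.
  { ring. }
  exists (fun _ y => s * y), (fun x _ => x).
  repeat split; auto using smooth_germ_snd, smooth_germ_mult, smooth_germ_const, smooth_germ_fst.
  - ring.
  - apply locally_2d_forall. intros x y. split; auto. rewrite <- Rmult_assoc, E. ring.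
  - apply locally_2d_forall. intros x y. split; auto. rewrite <- Rmult_assoc, E. ring.
Qed.

Lemma right_equiv_diffeo g k p1 p2 :
  diffeo_germ p1 p2 -> right_equiv g k ->
  right_equiv g (fun x y => k (p1 x y) (p2 x y)).
Proof.
  intros Hp [q1 [q2 [Hq E]]].
  exists (fun x y => q1 (p1 x y) (p2 x y)), (fun x y => q2 (p1 x y) (p2 x y)).
  split; [now apply diffeo_germ_comp|].
  destruct Hp as [H1 [H2 [H3 [H4 _]]]].
  now apply (locally_2d_germ_comp (fun x y => g (q1 x y) (q2 x y) = k x y)).
Qed.

Lemma right_equiv_ext g g' k k' :
  locally_2d (fun x y => g x y = g' x y) 0 0 -> (forall x y, k x y = k' x y) ->
  right_equiv g k -> right_equiv g' k'.
Proof.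
  intros eg ek [p1 [p2 [Hp E]]]. exists p1, p2. split; auto.
  destruct Hp as [H1 [H2 [H3 [H4 _]]]].
  pose proof (locally_2d_germ_comp _ _ _ H1 H2 H3 H4 eg) as L.
  apply locally_2d_impl with (2 := L), locally_2d_impl with (2 := E).
  apply locally_2d_forall. intros x y e1 e2. now rewrite <- ek, <- e1, e2.
Qed.

(** * Cuspidal germs and their normal form *)

Ltac smooth_germ_auto :=
  repeat first
    [ assumption | apply smooth_germ_const | apply smooth_germ_fst
    | apply smooth_germ_snd | apply smooth_germ_pow | apply smooth_germ_mult
    | apply smooth_germ_plus | apply smooth_germ_comp ].

(** A general element of the ideal $(y^3, xy^2, x^2)$: a germ whose Taylor series lacks the
    monomials $1$, $x$, $y$, $xy$ and $y^2$. *)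
Definition semicubic (N B C : R -> R -> R) (x y : R) : R :=
  y ^ 3 * N x y + x * y ^ 2 * B x y + x ^ 2 * C x y.

Lemma sign_abs t : t <> 0 -> exists s, is_sign s /\ 0 < s * t.
Proof.
  intros Ht. destruct (Rlt_dec 0 t).
  - exists 1. split; [now left|lra].
  - exists (-1). split; [now right|lra].
Qed.

Lemma Rpower_third_cube t : 0 < t -> Rpower t (/ 3) ^ 3 = t.
Proof.
  intros Ht. rewrite <- Rpower_pow by apply exp_pos. rewrite Rpower_mult.
  replace (/ 3 * INR 3) with 1 by (simpl; field). now apply Rpower_1.
Qed.

Lemma Rpower_half_sqr t : 0 < t -> Rpower t (/ 2) ^ 2 = t.
Proof.
  intros Ht. rewrite <- Rpower_pow by apply exp_pos. rewrite Rpower_mult.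
  replace (/ 2 * INR 2) with 1 by (simpl; field). now apply Rpower_1.
Qed.

(* Completing the square leaves [y^3 (N - y B^2 / (4 C))], whose second factor
   has the same value as [N] at the origin and hence a smooth cube root. *)
Lemma semicubic_normal_form N B C :
  smooth_germ N -> smooth_germ B -> smooth_germ C -> N 0 0 <> 0 -> C 0 0 <> 0 ->
  exists s1 s2, is_sign s1 /\ is_sign s2 /\
    right_equiv (semicubic N B C) (fun x y => s1 * y ^ 3 + s2 * x ^ 2).
Proof.
  intros HN HB HC N0 C0.
  destruct (sign_abs _ N0) as [s1 [Hs1 pN]]. destruct (sign_abs _ C0) as [s2 [Hs2 pC]].
  assert (E1 := is_sign_sqr s1 Hs1). assert (E2 := is_sign_sqr s2 Hs2).
  exists s1, s2. split; [auto|split; [auto|]].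
  (* Near the origin [D] is $|C|$ and [I] its reciprocal, so $1/C$ is [s2 * I]. Hence [T] is
     $B/(2C)$ and [Q] is $|N-yB^2/(4C)|$, both free of division. *)
  set (D := fun x y => s2 * C x y).
  assert (HD : smooth_germ D) by (unfold D; smooth_germ_auto).
  set (I := fun x y => Rpower (D x y) (- (1))).
  assert (HI : smooth_germ I) by now apply smooth_germ_Rpower.
  set (T := fun x y => s2 / 2 * (B x y * I x y)).
  assert (HT : smooth_germ T) by (unfold T; smooth_germ_auto).
  set (S := fun x y => Rpower (D x y) (/ 2)).
  assert (HS : smooth_germ S) by now apply smooth_germ_Rpower.
  set (Q := fun x y => s1 * (N x y + - s2 / 4 * (y * (B x y ^ 2 * I x y)))).
  assert (HQ : smooth_germ Q) by (unfold Q; smooth_germ_auto).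
  assert (Q0 : 0 < Q 0 0).
  { unfold Q. replace (s1 * (N 0 0 + - s2 / 4 * (0 * (B 0 0 ^ 2 * I 0 0))))
      with (s1 * N 0 0) by ring. exact pN. }
  set (u := fun x y => S x y * (x + y ^ 2 * T x y)).
  assert (Hu : smooth_germ u) by (unfold u; smooth_germ_auto).
  destruct (diffeo_germ_sym u (fun x y => y * Rpower (Q x y) (/ 3))) as [p1 [p2 [Hp Ep]]].
  { apply diffeo_germ_triangular; auto.
    - unfold u. ring.
    - replace (dx u 0 0) with (dx (fun x y => x * S x y) 0 0).
      + rewrite dx_mult_id; auto. apply exp_pos.
      + apply Derive_ext. intros x. unfold u. ring.
    - now apply smooth_germ_Rpower.
    - apply exp_pos. }
  exists p1, p2. split; auto.
  assert (L : locally_2d (fun x y => semicubic N B C x y =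
    s1 * (y * Rpower (Q x y) (/ 3)) ^ 3 + s2 * u x y ^ 2) 0 0).
  { pose proof (continuity_2d_pt_pos D 0 0 (smooth_germ_continuity D HD) pC) as L1.
    pose proof (continuity_2d_pt_pos Q 0 0 (smooth_germ_continuity Q HQ) Q0) as L2.
    apply locally_2d_impl with (2 := L1), locally_2d_impl with (2 := L2).
    apply locally_2d_forall. intros x y Qp Dp.
    unfold u. rewrite !Rpow_mult_distr, Rpower_third_cube by auto.
    unfold S. rewrite Rpower_half_sqr by auto.
    unfold Q, T, I. rewrite Rpower_Ropp, Rpower_1 by auto.
    assert (ED : s2 * D x y = C x y).
    { unfold D. rewrite <- Rmult_assoc, E2. ring. }
    unfold semicubic. rewrite <- ED.
    assert (NZ : D x y <> 0) by lra. revert NZ.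
    generalize (D x y) (B x y) (N x y). intros D' B' N' NZ.
    destruct Hs1 as [-> | ->], Hs2 as [-> | ->]; field; exact NZ. }
  destruct Hp as [H1 [H2 [H3 [H4 _]]]].
  apply (locally_2d_germ_comp _ p1 p2) in L; auto.
  apply locally_2d_impl with (2 := L), locally_2d_impl with (2 := Ep).
  apply locally_2d_forall. intros x y [e1 e2] ->. now rewrite e1, e2.
Qed.

Lemma semicubic_A2 N B C :
  smooth_germ N -> smooth_germ B -> smooth_germ C -> N 0 0 <> 0 -> C 0 0 <> 0 ->
  singularity_A2 (semicubic N B C).
Proof.
  intros HN HB HC N0 C0.
  destruct (semicubic_normal_form N B C) as [s1 [s2 [Hs1 [Hs2 E]]]]; auto.
  exists s2. split; auto.
  (* Substituting [s * x] for [y] turns [s1 * y ^ 3] into [s1 * s * x ^ 3]; the coefficient equals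
     [s2] exactly for [s = s1 * s2]. *)
  assert (Hs : is_sign (s1 * s2)).
  { destruct Hs1 as [-> | ->], Hs2 as [-> | ->]; unfold is_sign; lra. }
  apply (right_equiv_diffeo _ _ _ _ (diffeo_germ_swap_sign _ Hs)) in E.
  revert E. apply right_equiv_ext; [now apply locally_2d_forall|].
  intros x y. destruct Hs1 as [-> | ->], Hs2 as [-> | ->]; ring.
Qed.

(* On the curve [x = 0] a right equivalence would give [psi(y) = s] for
   [y <> 0], where [psi] is continuous and vanishes at the origin. *)
Lemma semicubic_not_A2 N B C :
  smooth_germ N -> smooth_germ B -> smooth_germ C -> C 0 0 = 0 ->
  ~ singularity_A2 (semicubic N B C).
Proof.
  intros HN HB HC C0 [s [Hs [p1 [p2 [Hp E]]]]].
  destruct Hp as [H1 [H2 [Z1 [Z2 _]]]].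
  destruct (hadamard_y p1 H1) as [P1 [HP1 e1]].
  destruct (hadamard_y p2 H2) as [P2 [HP2 e2]].
  (* On [x = 0] the diffeomorphism is [(y * P1, y * P2)], and [psi] is the composed germ divided by
     [y ^ 2]. Its value at the origin is [P1 0 0 ^ 2 * C 0 0], which is 0. *)
  set (psi := fun x y => y * P2 x y ^ 3 * N (p1 x y) (p2 x y) +
    P1 x y * (y * P2 x y ^ 2) * B (p1 x y) (p2 x y) + P1 x y ^ 2 * C (p1 x y) (p2 x y)).
  assert (Hpsi : smooth_germ psi) by (unfold psi; smooth_germ_auto).
  assert (psi0 : psi 0 0 = 0).
  { unfold psi. rewrite Z1, Z2, C0. ring. }
  pose proof (smooth_germ_continuity psi Hpsi (mkposreal 1 Rlt_0_1)) as L.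
  assert (L2 := locally_2d_and _ _ _ _ (locally_2d_and _ _ _ _ e1 e2)
    (locally_2d_and _ _ _ _ E L)).
  apply locally_2d_box in L2. destruct L2 as [d [pd Hd]].
  assert (Bd : box d 0 (d / 2)).
  { split; [now rewrite Rabs_R0|]. rewrite Rabs_pos_eq; lra. }
  destruct (Hd _ _ Bd) as [[f1 f2] [f3 f4]].
  set (y := d / 2) in *. assert (py : 0 < y) by (unfold y; lra). clearbody y.
  rewrite Z1, Rplus_0_l in f1. rewrite Z2, Rplus_0_l in f2.
  assert (Es : s = psi 0 y).
  { apply Rmult_eq_reg_l with (y ^ 2); [|apply pow_nonzero; lra].
    transitivity (s * (y ^ 2 + 0 ^ 3)); [ring|]. rewrite <- f3.
    unfold semicubic, psi. generalize (N (p1 0 y) (p2 0 y)) (B (p1 0 y) (p2 0 y))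
      (C (p1 0 y) (p2 0 y)). intros n b c. rewrite f1, f2. ring. }
  rewrite psi0, <- Es, Rminus_0_r in f4. simpl in f4.
  apply Rabs_lt_between in f4. destruct Hs; lra.
Qed.

(** * The second order geometry of the surface *)

Lemma partial_derive_plus F G i j :
  smooth_germ F -> smooth_germ G ->
  partial_derive i j (fun x y => F x y + G x y) 0 0 =
  partial_derive i j F 0 0 + partial_derive i j G 0 0.
Proof.
  intros HF HG. destruct (smooth_germ2_box F G HF HG) as [d [pd [HF' HG']]].
  pose proof (box_0 d pd) as B0. unfold partial_derive.
  assert (ey : forall H, smooth_on (box d) H -> forall x, box d x 0 ->
    locally 0 (fun y => forall k, (k <= j)%nat -> ex_derive_n (fun z => H x z) k y)).
  { intros H SH x Bx. apply filter_imp with (2 := locally_box_y d x 0 Bx).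
    intros y By [|k] _; [exact I|].
    apply (ex_diff_n_ex_deriv_inf_2 (S k) 0 k ltac:(lia) H x y), SH, By. }
  assert (ex : forall H, smooth_on (box d) H ->
    locally 0 (fun x => forall k, (k <= i)%nat ->
      ex_derive_n (fun t => Derive_n (fun z => H t z) j 0) k x)).
  { intros H SH. apply filter_imp with (2 := locally_box_x d 0 0 B0).
    intros x Bx [|k] _; [exact I|].
    apply (ex_diff_n_ex_deriv_inf_1 (S (k + j)) k j ltac:(lia) H x 0), SH, Bx. }
  rewrite <- Derive_n_plus by auto.
  apply Derive_n_ext_loc, filter_imp with (2 := locally_box_x d 0 0 B0).
  intros x Bx. apply Derive_n_plus; auto.
Qed.

Lemma order_ge_plus k F G :
  smooth_germ F -> smooth_germ G -> order_ge k F -> order_ge k G ->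
  order_ge k (fun x y => F x y + G x y).
Proof.
  intros HF HG OF OG i j Hij.
  rewrite partial_derive_plus, OF, OG by assumption. ring.
Qed.

Lemma smooth_germ_of_smooth1 h : smooth1_germ h -> smooth_germ (fun _ y => h y).
Proof.
  intros [d Hd]. apply smooth_germ_open with (box d); auto using open2_box.
  { apply box_0, cond_pos. }
  assert (D : forall k x y, box d x y -> is_derive (Derive_n h k) y (Derive_n h (S k) y)).
  { intros k x y [_ B]. apply Derive_correct. apply (Hd y) with (n := S k).
    change (Rabs (y - 0) < d). now rewrite Rminus_0_r. }
  (* The claim is generalised to every derivative of [h], since a partial derivative leads from
     [Derive_n h k] to [Derive_n h (S k)]. *)
  intros n. change (Cn (box d) n (fun _ y => Derive_n h 0 y)).
  generalize 0%nat. induction n as [|n IH]; intros k.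
  - intros x y B. split; [|exact I].
    apply (continuity_1d_2d_pt_comp (Derive_n h k) (fun _ y => y)).
    + apply continuity_pt_filterlim, (ex_derive_continuous (Derive_n h k)).
      exists (Derive_n h (S k) y). now apply D with x.
    + apply continuity_2d_pt_id2.
  - apply Cn_intro_partial with (fun _ _ => 0) (fun _ y => Derive_n h (S k) y);
      auto using open2_box, Cn_const.
    + intros x y _. apply (is_derive_const (K := R_AbsRing) (V := R_NormedModule)).
    + intros x y B. now apply (D k x y).
Qed.

Lemma order_ge_of_order1 k h : order1_ge k h -> order_ge k (fun _ y => h y).
Proof.
  intros Oh [|i] j Hij; unfold partial_derive.
  - apply Oh. lia.
  - rewrite Derive_n_const. reflexivity.
Qed.

(** One shape for the four components of the surface: [a] is 1 for the first and 0 for the others,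
    and a linear term in [y] is absent because the corank is 1. *)
Definition poly3 (a q20 q11 q02 p30 p21 p12 p03 x y : R) : R :=
  a * x + (q20 * x ^ 2 + q11 * x * y + q02 * y ^ 2) +
  (p30 * x ^ 3 + p21 * x ^ 2 * y + p12 * x * y ^ 2 + p03 * y ^ 3).

(** A remainder of order 4 is invisible to derivatives of order below 4, so the values are read off
    the explicit cubic. *)
Lemma partial_derives_poly3_plus g r a q20 q11 q02 p30 p21 p12 p03 :
  smooth_germ r -> order_ge 4 r ->
  locally_2d (fun x y => g x y = poly3 a q20 q11 q02 p30 p21 p12 p03 x y + r x y) 0 0 ->
  partial_derive 1 0 g 0 0 = a /\ partial_derive 0 1 g 0 0 = 0 /\
  partial_derive 2 0 g 0 0 = 2 * q20 /\ partial_derive 1 1 g 0 0 = q11 /\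
  partial_derive 0 2 g 0 0 = 2 * q02.
Proof.
  intros Hr Or E.
  set (P := poly3 a q20 q11 q02 p30 p21 p12 p03) in *.
  assert (HP : smooth_germ P) by (unfold P, poly3, Rdiv; smooth_germ_auto).
  assert (Z : forall i j, (i + j < 4)%nat -> partial_derive i j g 0 0 = partial_derive i j P 0 0).
  { intros i j Hij. rewrite (partial_derive_ext_loc _ _ i j 0 0 E).
    rewrite partial_derive_plus, (Or i j Hij) by auto. ring. }
  rewrite !Z by lia. unfold P, poly3, partial_derive; simpl.
  repeat split.
  - apply is_derive_unique. auto_derive; [exact I|ring].
  - apply is_derive_unique. auto_derive; [exact I|ring].
  - rewrite (Derive_ext _ (fun x => a + 2 * q20 * x + 3 * p30 * x ^ 2)).
    + apply is_derive_unique. auto_derive; [exact I|ring].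
    + intros x. apply is_derive_unique. auto_derive; [exact I|ring].
  - rewrite (Derive_ext _ (fun x => q11 * x + p21 * x ^ 2)).
    + apply is_derive_unique. auto_derive; [exact I|ring].
    + intros x. apply is_derive_unique. auto_derive; [exact I|ring].
  - rewrite (Derive_ext _ (fun y => 2 * q02 * y + 3 * p03 * y ^ 2)).
    + apply is_derive_unique. auto_derive; [exact I|ring].
    + intros x. apply is_derive_unique. auto_derive; [exact I|ring].
Qed.

(** * Affine span of the curvature parabola and umbilic curvature *)

Lemma affine_hull_contains S w : S w -> affine_hull S w.
Proof. intros Sw A _ HA. now apply HA. Qed.

Lemma affine_subspace_hull S : affine_subspace (affine_hull S).
Proof. intros a b t Ha Hb A HA HS. apply HA; [now apply Ha|now apply Hb]. Qed.

Lemma affine_subspace_cW k : affine_subspace (fun w => cW w = k).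
Proof.
  intros a b t Ha Hb. change (cW a + t * (cW b - cW a) = k). rewrite Ha, Hb. ring.
Qed.

Lemma norm4_cW w : Rabs (cW w) <= norm4 w.
Proof.
  unfold norm4. rewrite <- sqrt_Rsqr_abs. apply sqrt_le_1_alt. unfold Rsqr, dot. nra.
Qed.

Lemma R4_ext (u w : R4) :
  cX u = cX w -> cY u = cY w -> cZ u = cZ w -> cW u = cW w -> u = w.
Proof.
  destruct u as [[[? ?] ?] ?], w as [[[? ?] ?] ?]. cbn. now intros -> -> -> ->.
Qed.

(** The geometry of the curvature parabola sees [f] only through these values; [k] stands for
    $c_{20}$. *)
Definition has_second_jet (f : R -> R -> R4) (b20 b11 b02 k : R) : Prop :=
  partial4 1 0 f = (1, 0, 0, 0) /\ partial4 0 1 f = (0, 0, 0, 0) /\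
  partial4 2 0 f = (0, 0, 2 * b20, 2 * k) /\ partial4 1 1 f = (0, 1, b11, 0) /\
  partial4 0 2 f = (0, 0, 2 * b02, 0).

Lemma df0_eq f b20 b11 b02 k u :
  has_second_jet f b20 b11 b02 k -> df0 f u = (fst u, 0, 0, 0).
Proof.
  intros [f10 [f01 _]]. unfold df0. rewrite f10, f01. apply R4_ext; cbn; ring.
Qed.

(** The tangent space is the [X]-axis, so normal projection preserves [W]. The unit condition makes
    the first component of [u] equal to 1 or -1, and only its square enters the [W] coordinate. *)
Lemma curvature_parabola_cW f b20 b11 b02 k n :
  has_second_jet f b20 b11 b02 k -> curvature_parabola f n -> cW n = 2 * k.
Proof.
  intros Hf [u [Hu [_ [t Ht]]]]. rewrite (df0_eq _ _ _ _ _ _ Hf) in Ht.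
  rewrite (df0_eq _ _ _ _ _ _ Hf) in Hu.
  destruct Hf as [_ [_ [f20 [f11 f02]]]].
  unfold norm4, dot in Hu; cbn in Hu.
  assert (u2 : fst u * fst u = 1).
  { replace (fst u * fst u + 0 * 0 + 0 * 0 + 0 * 0) with (fst u * fst u) in Hu by ring.
    rewrite <- (sqrt_sqrt (fst u * fst u)) by nra. rewrite Hu. ring. }
  apply (f_equal cW) in Ht. unfold d2f0 in Ht. rewrite f20, f11, f02 in Ht.
  change (fst u * fst u * (2 * k) + (fst u * snd u + snd u * fst u) * 0 + snd u * snd u * 0
    - cW n = 0) in Ht.
  rewrite u2 in Ht. lra.
Qed.

(** The direction is [(1, s)]; its second derivative has no [X] component and so is its own normal
    projection. *)
Lemma curvature_parabola_point f b20 b11 b02 k s :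
  has_second_jet f b20 b11 b02 k -> 
  curvature_parabola f (0, 2 * s, 2 * b20 + 2 * s * b11 + s ^ 2 * (2 * b02), 2 * k).
Proof.
  intros Hf. exists (1, s). split.
  - rewrite (df0_eq _ _ _ _ _ _ Hf). unfold norm4, dot; cbn. transitivity (sqrt 1); [f_equal; ring|apply sqrt_1].
  - split.
    + intros t [u ->]. rewrite (df0_eq _ _ _ _ _ _ Hf). unfold dot; cbn. ring.
    + exists (0, 0). rewrite (df0_eq _ _ _ _ _ _ Hf). unfold d2f0.
      destruct Hf as [_ [_ [f20 [f11 f02]]]]. rewrite f20, f11, f02.
      apply R4_ext; cbn; ring.
Qed.

Lemma Aff_p_cW f b20 b11 b02 k w :
  has_second_jet f b20 b11 b02 k -> Aff_p f w -> cW w = 2 * k.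
Proof.
  intros Hf Hw. apply (Hw (fun w => cW w = 2 * k)); [apply affine_subspace_cW|].
  intros n. now apply curvature_parabola_cW with b20 b11 b02.
Qed.

Lemma E_p_cW f b20 b11 b02 k w : has_second_jet f b20 b11 b02 k -> E_p f w -> cW w = 0.
Proof.
  intros Hf [a [b [Ha [Hb ->]]]]. change (cW a - cW b = 0).
  rewrite (Aff_p_cW _ _ _ _ _ _ Hf Ha), (Aff_p_cW _ _ _ _ _ _ Hf Hb). ring.
Qed.

(* The midpoint of the points of parameter 1 and -1 is joined to the vertex of
   parameter 0 by a line in the Z-direction, on which Z takes the value 0. *)
Lemma Aff_p_on_W_axis f b20 b11 b02 k :
  has_second_jet f b20 b11 b02 k -> b02 <> 0 -> Aff_p f (0, 0, 0, 2 * k).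
Proof.
  intros Hf Hb.
  pose proof (affine_hull_contains _ _ (curvature_parabola_point _ _ _ _ _ 1 Hf)) as H1.
  pose proof (affine_hull_contains _ _ (curvature_parabola_point _ _ _ _ _ (-1) Hf)) as H2.
  pose proof (affine_hull_contains _ _ (curvature_parabola_point _ _ _ _ _ 0 Hf)) as H0.
  pose proof (affine_subspace_hull _ _ _ (/ 2) H1 H2) as Hm.
  pose proof (affine_subspace_hull _ _ _ (- b20 / b02) H0 Hm) as H.
  unfold Aff_p. match type of H with affine_hull _ ?w =>
    replace (0, 0, 0, 2 * k) with w; [exact H|] end.
  apply R4_ext; cbn; field; exact Hb.
Qed.

(** All points of [Aff_p f] share the [W] coordinate [2 * k], which bounds their norms from below;
    the point on the [W]-axis attains the bound. *)
Lemma umbilic_curvature_eq f b20 b11 b02 k :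
  has_second_jet f b20 b11 b02 k -> b02 <> 0 -> umbilic_curvature f = Rabs (2 * k).
Proof.
  intros Hf Hb. unfold umbilic_curvature.
  rewrite (is_glb_Rbar_unique _ (Finite (Rabs (2 * k)))); [reflexivity|].
  split.
  - intros d [w [Hw ->]]. simpl. unfold dist4.
    eapply Rle_trans; [|apply norm4_cW].
    change (cW (minus zero w)) with (0 - cW w). rewrite (Aff_p_cW _ _ _ _ _ _ Hf Hw).
    rewrite Rminus_0_l, Rabs_Ropp. apply Rle_refl.
  - intros l Hl. apply (Hl (Rabs (2 * k))).
    exists (0, 0, 0, 2 * k). split; [now apply Aff_p_on_W_axis with b20 b11 b02|].
    unfold dist4, norm4. rewrite <- sqrt_Rsqr_abs. f_equal.
    unfold dot, Rsqr; cbn. ring.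
Qed.

(** * Contact with the model surface and the equivalence *)

Lemma is_linear_cX : is_linear (cX : R4 -> R).
Proof.
  apply (is_linear_comp (fun w : R4 => fst (fst w)) fst); [|apply is_linear_fst].
  apply (is_linear_comp fst fst); apply is_linear_fst.
Qed.

Lemma g4_submersion s1 s2 : is_sign s1 -> submersion_germ (g4 s1 s2).
Proof.
  intros Hs.
  (* The second summand is the zero differential of $X^2$ at the origin, in the form that the chain
     rule produces; the [W] direction shows that the sum is nonzero. *)
  exists (fun w => plus (scal s1 (cW w)) (scal s2 (scal (cX w) 0))). split.
  - apply (filterdiff_plus_fct (F := locally (zero : R4))
      (fun w => s1 * cW w) (fun w => s2 * cX w ^ 2)).
    + apply (filterdiff_scal_r_fct s1 cW); [exact Rmult_comm|].
      apply filterdiff_linear, is_linear_snd.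
    + apply (filterdiff_scal_r_fct s2 (fun w => cX w ^ 2)); [exact Rmult_comm|].
      apply (filterdiff_comp' cX (fun x => x ^ 2) zero cX (fun t => scal t 0)).
      * apply filterdiff_linear, is_linear_cX.
      * change (is_derive (fun x => x ^ 2) 0 0). auto_derive; [exact I|ring].
  - exists (0, 0, 0, 1). cbn. destruct Hs as [-> | ->]; lra.
Qed.

Theorem proposition4p11
  (f : R -> R -> R4) (h : R -> R) (b c : nat -> nat -> R)
  (r1 r2 r3 r4 : R -> R -> R) (v4 : R)
  (h_smooth : smooth1_germ h) (h_order : order1_ge 4 h)
  (r1_smooth : smooth_germ r1) (r1_order : order_ge 4 r1)
  (r2_smooth : smooth_germ r2) (r2_order : order_ge 4 r2)
  (r3_smooth : smooth_germ r3) (r3_order : order_ge 4 r3)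
  (r4_smooth : smooth_germ r4) (r4_order : order_ge 4 r4)
  (f_param : locally_2d (fun x y =>
     f x y = (x + r1 x y,
              x * y + h y + r2 x y,
              homog 2 b x y + homog 3 b x y + r3 x y,
              c 2%nat 0%nat * x ^ 2 + homog 3 c x y + r4 x y)) 0 0)
  (b02_c03 : b 0%nat 2%nat * c 0%nat 3%nat <> 0)
  (v_unit : norm4 (0, 0, 0, v4) = 1) (v4_neq0 : v4 <> 0) :
  (forall w, E_p f w -> hyperplane_orth (0, 0, 0, v4) w) /\
  (forall w, tangent_cone_XZ w -> hyperplane_orth (0, 0, 0, v4) w) /\
  ((singularity_A2 (height f (0, 0, 0, v4)) /\
    exists s1 s2, is_sign s1 /\ is_sign s2 /\
      described_by_contact (height f (0, 0, 0, v4)) (g4 s1 s2))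
   <-> umbilic_curvature f <> 0).
Proof.
  assert (b02 : b 0%nat 2%nat <> 0) by (intros e; apply b02_c03; rewrite e; ring).
  assert (c03 : c 0%nat 3%nat <> 0) by (intros e; apply b02_c03; rewrite e; ring).
  assert (orth : forall w, cW w = 0 -> hyperplane_orth (0, 0, 0, v4) w).
  { intros w Hw. unfold hyperplane_orth, dot. rewrite Hw. cbn. ring. }
  assert (jet : has_second_jet f (b 2%nat 0%nat) (b 1%nat 1%nat) (b 0%nat 2%nat)
                  (c 2%nat 0%nat)).
  { set (hh := fun _ y : R => h y).
    assert (Hhh : smooth_germ hh) by exact (smooth_germ_of_smooth1 h h_smooth).
    assert (Ohh : order_ge 4 hh) by exact (order_ge_of_order1 4 h h_order).
    assert (JX := partial_derives_poly3_plus (fun x y => cX (f x y)) r1 1 0 0 0 0 0 0 0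
      r1_smooth r1_order).
    assert (JY := partial_derives_poly3_plus (fun x y => cY (f x y))
      (fun x y => hh x y + r2 x y) 0 0 1 0 0 0 0 0
      (smooth_germ_plus _ _ Hhh r2_smooth)
      (order_ge_plus _ _ _ Hhh r2_smooth Ohh r2_order)).
    assert (JZ := partial_derives_poly3_plus (fun x y => cZ (f x y)) r3 0
      (b 2%nat 0%nat) (b 1%nat 1%nat) (b 0%nat 2%nat)
      (b 3%nat 0%nat) (b 2%nat 1%nat) (b 1%nat 2%nat) (b 0%nat 3%nat) r3_smooth r3_order).
    assert (JW := partial_derives_poly3_plus (fun x y => cW (f x y)) r4 0
      (c 2%nat 0%nat) 0 0
      (c 3%nat 0%nat) (c 2%nat 1%nat) (c 1%nat 2%nat) (c 0%nat 3%nat) r4_smooth r4_order).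
    destruct JX as [X10 [X01 [X20 [X11 X02]]]].
    { apply locally_2d_impl with (2 := f_param), locally_2d_forall.
      intros x y ->. unfold poly3; cbn. ring. }
    destruct JY as [Y10 [Y01 [Y20 [Y11 Y02]]]].
    { apply locally_2d_impl with (2 := f_param), locally_2d_forall.
      intros x y ->. unfold poly3, hh; cbn. ring. }
    destruct JZ as [Z10 [Z01 [Z20 [Z11 Z02]]]].
    { apply locally_2d_impl with (2 := f_param), locally_2d_forall.
      intros x y ->. unfold poly3, homog; cbn. ring. }
    destruct JW as [W10 [W01 [W20 [W11 W02]]]].
    { apply locally_2d_impl with (2 := f_param), locally_2d_forall.
      intros x y ->. unfold poly3, homog; cbn. ring. }
    unfold has_second_jet, partial4.
    rewrite X10, X01, X20, X11, X02, Y10, Y01, Y20, Y11, Y02,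
      Z10, Z01, Z20, Z11, Z02, W10, W01, W20, W11, W02.
    rewrite !Rmult_0_r. auto. }
  destruct (taylor_remainder_factor r4 r4_smooth r4_order)
    as [R0 [R1 [R2 [HR0 [HR1 [HR2 [R20 ER]]]]]]].
  (* Each term of the height goes to the generator of the ideal dividing it: $c_{03}y^3$ and
     $y^4R_0$ to [N], $c_{12}xy^2$ and $xy^2R_1$ to [B], all multiples of $x^2$ to [C]. *)
  set (N := fun x y => v4 * (c 0%nat 3%nat + y * R0 x y)).
  set (B := fun x y => v4 * (c 1%nat 2%nat + R1 x y)).
  set (C := fun x y => v4 * (c 2%nat 0%nat + c 3%nat 0%nat * x + c 2%nat 1%nat * y + R2 x y)).
  assert (HN : smooth_germ N) by (unfold N; smooth_germ_auto).
  assert (HB : smooth_germ B) by (unfold B; smooth_germ_auto).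
  assert (HC : smooth_germ C) by (unfold C; smooth_germ_auto).
  assert (N0 : N 0 0 <> 0).
  { unfold N. rewrite Rmult_0_l, Rplus_0_r. now apply Rmult_integral_contrapositive. }
  assert (C0 : C 0 0 = v4 * c 2%nat 0%nat) by (unfold C; rewrite R20; ring).
  assert (Eh : locally_2d (fun x y =>
    semicubic N B C x y = height f (0, 0, 0, v4) x y) 0 0).
  { apply locally_2d_impl with (2 := f_param), locally_2d_impl with (2 := ER).
    apply locally_2d_forall. intros x y e e'.
    unfold height. rewrite e'. unfold dot, semicubic, N, B, C, homog; cbn -[pow].
    rewrite e. cbn. ring. }
  split; [|split; [|split]].
  - intros w Hw. apply orth. now apply (E_p_cW _ _ _ _ _ _ jet).
  - intros w [_ Hw]. now apply orth.
  - intros [[s [Hs HA]] _] Hk.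
    rewrite (umbilic_curvature_eq _ _ _ _ _ jet b02) in Hk.
    apply (semicubic_not_A2 N B C); auto.
    + rewrite C0. apply Rabs_eq_0 in Hk. nra.
    + exists s. split; auto. revert HA. apply right_equiv_ext; auto.
      apply locally_2d_impl with (2 := Eh), locally_2d_forall. auto.
  - rewrite (umbilic_curvature_eq _ _ _ _ _ jet b02). intros Hk.
    assert (C0' : C 0 0 <> 0).
    { rewrite C0. apply Rmult_integral_contrapositive. split; auto.
      intros e. apply Hk. rewrite e, Rmult_0_r. apply Rabs_R0. }
    split.
    + destruct (semicubic_A2 N B C) as [s [Hs E]]; auto.
      exists s. split; auto. revert E. now apply right_equiv_ext.
    (* On the model surface [g4 s1 s2] is [s1 * y ^ 3 + s2 * x ^ 2], which is the normal form
       itself; its signs are therefore the ones to take. *)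
    + destruct (semicubic_normal_form N B C) as [s1 [s2 [Hs1 [Hs2 E]]]]; auto.
      exists s1, s2. split; [auto|split; [auto|split]].
      * now apply g4_submersion.
      * revert E. now apply right_equiv_ext.
Qed.
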